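(* Let $p\ge 3$, let $\boldsymbol{\Sigma}=\mathrm{diag}(\sigma_1^2,\dots,\sigma_p^2)$ with $\sigma_1^2>\sigma_2^2>\dots>\sigma_p^2>0$, and let $\boldsymbol{G}=\mathrm{diag}(g_1,\dots,g_p)$ with $0<g_i\le 1$ for all $i$. Let $\phi:[0,\infty)\to\mathbb{R}$ be non-negative, non-decreasing and concave, and such that $z\mapsto \phi(z)/z$ is non-increasing on $(0,\infty)$. Then the estimator $$\boldsymbol{\delta}_\phi(\boldsymbol{x})=\left(\boldsymbol{I}-\boldsymbol{G}\,\frac{\phi(z)}{z}\right)\boldsymbol{x},\qquad z=\boldsymbol{x}^{\mathsf T}\boldsymbol{G}\boldsymbol{\Sigma}^{-1}\boldsymbol{x}=\sum_{i=1}^p\frac{g_i x_i^2}{\sigma_i^2},$$ is ensemble minimax (with respect to $\mathcal{P}_\star$) if $$\phi\Big(p\min_i g_i(1+\tau/\sigma_i^2)\Big)\le 2(p-2)\,\frac{\min_i g_i(1+\tau/\sigma_i^2)}{\max_i g_i(1+\tau/\sigma_i^2)}\qquad\text{for all }\tau\in(0,\infty),$$ where minima and maxima are over $i\in\{1,\dots,p\}$.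
   Context: One observes $\boldsymbol{X}\sim N_p(\boldsymbol{\theta},\boldsymbol{\Sigma})$ with $\boldsymbol{\Sigma}$ known and $\boldsymbol{\theta}\in\mathbb{R}^p$ unknown. An estimator is a measurable map $\boldsymbol{\delta}:\mathbb{R}^p\to\mathbb{R}^p$ (it only needs to be defined almost everywhere, e.g. off $\boldsymbol{x}=\boldsymbol{0}$). Its risk is $R(\boldsymbol{\delta},\boldsymbol{\theta})=E\left[\|\boldsymbol{\delta}(\boldsymbol{X})-\boldsymbol{\theta}\|^2\right]$, where $\boldsymbol{X}\sim N_p(\boldsymbol{\theta},\boldsymbol{\Sigma})$. For $\tau\in(0,\infty)$ the ensemble risk is $$\bar R(\boldsymbol{\delta},\tau)=\int_{\mathbb{R}^p}R(\boldsymbol{\delta},\boldsymbol{\theta})\frac{1}{(2\pi\tau)^{p/2}}\exp\left(-\frac{\|\boldsymbol{\theta}\|^2}{2\tau}\right)d\boldsymbol{\theta}.$$ Let $\mathcal{P}_\star=\{N_p(\boldsymbol{0},\tau\boldsymbol{I}_p):\tau\in(0,\infty)\}$. An estimator $\boldsymbol{\delta}$ is called ensemble minimax (with respect to $\mathcal{P}_\star$) if $\sup_{\tau\in(0,\infty)}\bar R(\boldsymbol{\delta},\tau)=\inf_{\boldsymbol{\delta}'}\sup_{\tau\in(0,\infty)}\bar R(\boldsymbol{\delta}',\tau)$, the infimum being over all estimators $\boldsymbol{\delta}'$. *)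

(* Defs.v *)
From HB Require Import structures.
From mathcomp Require Import all_boot all_order all_algebra.
From mathcomp Require Import all_classical all_reals all_analysis.

Set Implicit Arguments.
Unset Strict Implicit.
Unset Printing Implicit Defensive.
Import Order.TTheory GRing.Theory Num.Theory.
Local Open Scope classical_set_scope.
Local Open Scope ring_scope.

(* Lebesgue measure on R^n, with R^n encoded as n.-tuple R (product
   sigma-algebra): the n-fold product of the one-dimensional measure. The
   domain of tcons uses measurableTypeR R because that is the carrier of
   lebesgue_measure. *)
Section lebesgue_tuple.
Context {R : realType}.
Implicit Type n : nat.

Definition tcons n (u : measurableTypeR R * n.-tuple R) : n.+1.-tuple R :=
  [tuple of u.1 :: u.2].

Lemma measurable_tcons n : measurable_fun setT (@tcons n).
Proof. by apply: (@measurable_cons _ _ _ R fst _ snd). Qed.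

Definition lebesgueS n (m : {sigma_finite_measure set (n.-tuple R) -> \bar R}) :
    set (n.+1.-tuple R) -> \bar R :=
  pushforward (@lebesgue_measure R \x m)%E (@tcons n).

Section lebesgueS_measure.
Context n (m : {sigma_finite_measure set (n.-tuple R) -> \bar R}).

Let lebesgueS0 : lebesgueS m set0 = 0%E.
Proof. by rewrite /lebesgueS /pushforward preimage_set0 measure0. Qed.

Let lebesgueS_ge0 A : (0 <= lebesgueS m A)%E.
Proof. exact: (measure_ge0 (@lebesgue_measure R \x m)%E). Qed.

Let lebesgueS_sigma_additive : semi_sigma_additive (lebesgueS m).
Proof.
move=> F mF tF mUF; rewrite /lebesgueS /pushforward preimage_bigcup.
have mp A : measurable A -> measurable (@tcons n @^-1` A).
  by move=> mA; rewrite -[X in measurable X]setTI; exact: measurable_tcons.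
apply: measure_semi_sigma_additive.
- by move=> k; exact: mp.
- apply/trivIsetP => /= i j _ _ ij; rewrite -preimage_setI.
  by move/trivIsetP : tF => /(_ _ _ _ _ ij) ->//; rewrite preimage_set0.
- by rewrite -preimage_bigcup; exact: mp.
Qed.

HB.instance Definition _ := isMeasure.Build _ _ _ (lebesgueS m)
  lebesgueS0 lebesgueS_ge0 lebesgueS_sigma_additive.

(* Proved by hand: the library's canonical sigma-finite structure on \x is only
   inferred when both factors are subprobabilities. *)
Let lebesgueS_sigma_finite : sigma_finite setT (lebesgueS m).
Proof.
have /sigma_finiteP[F [FT ndF Foo]] := sigma_finiteT (@lebesgue_measure R).
have /sigma_finiteP[G [GT ndG Goo]] := sigma_finiteT m.
have mthead : measurable_fun setT (fun t : n.+1.-tuple R => thead t).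
  exact: (measurable_tnth ord0).
have mbehead := @measurable_behead _ R n.
have beheadK x (t : n.-tuple R) : [tuple of behead (tcons (x, t))] = t.
  exact/val_inj.
exists (fun k => [set t : n.+1.-tuple R |
    F k (thead t) /\ G k [tuple of behead t]]).
  rewrite predeqE => t; split => // _.
  have [i _ Fi] : (\bigcup_i F i) (thead t) by rewrite -FT.
  have [j _ Gj] : (\bigcup_j G j) [tuple of behead t] by rewrite -GT.
  exists (maxn i j) => //; split.
  - by move: Fi; exact/subsetPset/ndF/leq_maxl.
  - by move: Gj; exact/subsetPset/ndG/leq_maxr.
move=> k; have [mF Fk] := Foo k; have [mG Gk] := Goo k; split.
  apply: measurableI; rewrite -[X in measurable X]setTI.
  - exact: mthead.
  - exact: mbehead.
rewrite /lebesgueS /pushforward (_ : _ @^-1` _ = F k `*` G k).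
  by rewrite product_measure1E// lte_mul_pinfty// ge0_fin_numE.
by apply/seteqP; split => -[x t] /=; rewrite theadE beheadK.
Qed.

HB.instance Definition _ := Measure_isSigmaFinite.Build _ _ _ (lebesgueS m)
  lebesgueS_sigma_finite.

End lebesgueS_measure.

Fixpoint lebesgue_tuple_rec n :
    {sigma_finite_measure set (n.-tuple R) -> \bar R} :=
  match n with
  | 0 => \d_([tuple] : 0.-tuple R)
  | k.+1 => lebesgueS (lebesgue_tuple_rec k)
  end.

Definition lebesgue_tuple n : set (n.-tuple R) -> \bar R :=
  lebesgue_tuple_rec n.

HB.instance Definition _ n := SigmaFiniteMeasure.on (@lebesgue_tuple n).

End lebesgue_tuple.
Arguments lebesgue_tuple {R} n _.

Lemma lebesgue_tuple_box (R : realType) n (A : 'I_n -> set R) :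
  (forall i, measurable (A i)) ->
  lebesgue_tuple n [set t | forall i, A i (tnth t i)] =
  (\prod_(i < n) lebesgue_measure (A i))%E.
Proof.
elim: n A => [|n IH] A mA.
  rewrite big_ord0 /lebesgue_tuple/= /dirac indicE mem_set//=; by case.
rewrite big_ord_recl -IH; last by move=> i; exact: mA.
have mB : measurable [set t : n.-tuple R | forall i, A (lift ord0 i) (tnth t i)].
  rewrite (_ : mkset _ = \bigcap_(i in setT) ((@tnth n R)^~ i @^-1` A (lift ord0 i))).
    apply: fin_bigcap_measurable; first exact: finite_finset.
    by move=> i _; rewrite -[X in measurable X]setTI; exact: measurable_tnth.
  by apply/seteqP; split => t /= tA i; [move=> _; exact: tA|exact: tA].
rewrite -product_measure1E //; try exact: mA.
rewrite /lebesgue_tuple /= /lebesgueS /pushforward; congr (_ _).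
apply/seteqP; split => -[x t] /= => [H|[H1 H2] i].
  split; first exact: (H ord0).
  by move=> i; have := H (lift ord0 i); rewrite tnthS.
by case: (unliftP ord0 i) => [j|] ->; rewrite ?tnthS.
Qed.

Section ensemble_minimax.
Context {R : realType} {p : nat}.
Implicit Types (Sigma G : 'M[R]_p) (delta : p.-tuple R -> p.-tuple R).

Definition cvec (x : p.-tuple R) : 'cV[R]_p := \col_i tnth x i.

Definition tuple_of_cvec (v : 'cV[R]_p) : p.-tuple R :=
  [tuple v i 0 | i < p].

Definition sqnorm (v : 'cV[R]_p) : R := \sum_(i < p) v i 0 ^+ 2.

(* The Lebesgue density of N_p(theta, Sigma), for Sigma positive definite. *)
Definition mvnormal_pdf (theta : 'cV[R]_p) Sigma (x : 'cV[R]_p) : R :=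
  ((2 * pi) `^ (p%:R / 2) * Num.sqrt (\det Sigma))^-1 *
  expR (- ((x - theta)^T *m invmx Sigma *m (x - theta)) 0 0 / 2).

(* Estimators are total; as the risk does not depend on values on null sets,
   this is the same as considering maps that are defined almost everywhere. *)
Definition estimator delta := measurable_fun setT delta.

Definition risk Sigma delta (theta : p.-tuple R) : \bar R :=
  \int[lebesgue_tuple p]_x
    (sqnorm (cvec (delta x) - cvec theta)
     * mvnormal_pdf (cvec theta) Sigma (cvec x))%:E.

Definition ensemble_risk Sigma delta (tau : R) : \bar R :=
  \int[lebesgue_tuple p]_theta
    (risk Sigma delta theta *
     (((2 * pi * tau) `^ (p%:R / 2))^-1
      * expR (- sqnorm (cvec theta) / (2 * tau)))%:E).

Definition sup_ensemble_risk Sigma delta : \bar R :=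
  ereal_sup [set ensemble_risk Sigma delta tau | tau in [set tau | 0 < tau]].

Definition ensemble_minimax Sigma delta : Prop :=
  estimator delta /\
  sup_ensemble_risk Sigma delta =
    ereal_inf [set sup_ensemble_risk Sigma delta' | delta' in estimator].

(* At x = 0 the quotient is phi 0 / 0 = 0, hence delta_phi 0 = 0. *)
Definition shrinkage_estimator Sigma G (phi : R -> R) (x : p.-tuple R) :
    p.-tuple R :=
  let v := cvec x in
  let z := (v^T *m G *m invmx Sigma *m v) 0 0 in
  tuple_of_cvec ((1%:M - (phi z / z) *: G) *m v).

End ensemble_minimax.

(* The value for p = 0 is irrelevant. *)
Definition fmin {R : realType} {p : nat} : ('I_p -> R) -> R :=
  match p with
  | 0 => fun=> 0
  | _.+1 => fun F => \big[Num.min/F ord0]_i F i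
  end.

Definition fmax {R : realType} {p : nat} : ('I_p -> R) -> R :=
  match p with
  | 0 => fun=> 0
  | _.+1 => fun F => \big[Num.max/F ord0]_i F i
  end.

(* Main.v *)
Require Import Defs.
From HB Require Import structures.
From mathcomp Require Import all_boot all_order all_algebra.
From mathcomp Require Import all_classical all_reals all_analysis.
From mathcomp Require Import measurable_realfun ring lra.
Set Implicit Arguments.
Unset Strict Implicit.
Unset Printing Implicit Defensive.
Import Order.TTheory GRing.Theory Num.Theory.
Import numFieldNormedType.Exports.
Local Open Scope classical_set_scope.
Local Open Scope ring_scope.

(**
Write s_i for the variance sigma_i^2, and put v_i = s_i tau / (s_i + tau) and
b_i = tau / (s_i + tau).

Reduction to a marginal expectation. When theta is drawn from N(0, tau I), the
coordinates of x are independent with laws N(0, s_i + tau), and given x the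
coordinates of theta are independent with means b_i x_i and variances
v_i. So the ensemble risk of any estimator is the expectation of
sum_i ((delta_i(x) - b_i x_i)^2 + v_i) under the marginal law of x
([ensemble_risk_posterior]). It is at least sum_i v_i, which tends to sum_i s_i
as tau grows; hence no estimator has a supremum below sum_i s_i
([sup_ensemble_risk_ge]), and it remains to bound the risk of the shrinkage
estimator by sum_i s_i for each tau.

One coordinate at a time. Put u = phi(z)/z, h = u x_i^2 and
a_i = g_i (1 + tau / s_i). Expanding the square, the bound for the coordinate i
says E[a_i u h] <= 2 E[h].

Linearization. Let Q = sum_i x_i^2 / (s_i + tau), a chi-square variable with p
degrees of freedom. Since z = sum_i a_i x_i^2 / (s_i + tau) >= A Q with
A = min a, the monotonicity of phi(z)/z gives a_i u <= max a * phi(A Q) / (A Q),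
and the tangent to the concave function phi at p A, of slope m >= 0, turns this
into a_i u <= alpha / Q + beta with alpha = (max a / A) (phi(p A) - m p A) >= 0
and beta = max a * m ([scaled_shrink_le]).

The key inequality. As phi is nondecreasing, h is nondecreasing along rays, and
for such functions E[h / Q] <= E[h] / (p - 2) ([gausses_div_wsq_le]), with
equality for a constant h. Indeed h(x) <= h(r x) for r >= 1, so that
substituting r x for x gives
int h exp(- r^2 Q / 2) <= r^-p int h exp(- Q / 2); multiply by r and integrate
over r >= 1, exchanging the integrals on the left ([gauss_integral_shells]).
Polar coordinates and the independence of norm and direction are thus avoided.
It follows that E[a_i u h] <= (alpha / (p - 2) + beta) E[h], and the assumed
bound on phi(p A) makes the factor at most
2 + beta (1 - p / (p - 2)) <= 2.
*)

(** * Integration over real tuples *)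

Lemma integral_lebesgue_tuple0 (R : realType) (f : 0.-tuple R -> \bar R) :
  (\int[lebesgue_tuple 0]_x f x = f [tuple])%E.
Proof.
rewrite (_ : f = cst (f [tuple])); last by apply/funext => x; rewrite tuple0.
by rewrite integral_dirac ?diracT ?mul1e.
Qed.

Lemma integral_lebesgue_tupleS (R : realType) n (f : n.+1.-tuple R -> \bar R) :
  measurable_fun setT f -> (forall x, 0 <= f x)%E ->
  (\int[lebesgue_tuple n.+1]_x f x =
   \int[lebesgue_measure]_u \int[lebesgue_tuple n]_v f (tcons (u, v)))%E.
Proof.
move=> mf f0.
rewrite -(fubini_tonelli1 (f \o @tcons R n)) //=; last first.
  by apply: measurableT_comp => //; exact: measurable_tcons.
rewrite /lebesgue_tuple /= /lebesgueS.
rewrite ge0_integral_pushforward //; exact: measurable_tcons.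
Qed.

(** Both sides are measures in [A], so it suffices to compare them on bounded
intervals. *)
Lemma lebesgue_measure_affine (R : realType) (r c : R) (A : set R) : 0 < r ->
  measurable A ->
  (pushforward (@lebesgue_measure R)
     ((fun x => r * x + c)%R : measurableTypeR R -> measurableTypeR R) A
   = (r^-1)%:E * lebesgue_measure A)%E.
Proof.
move=> r0 mA.
have mr : measurable_fun setT
    ((fun x => r * x + c) : measurableTypeR R -> measurableTypeR R).
  by apply: measurable_funD => //; exact: measurable_funM.
pose nu : {measure set (measurableTypeR R) -> \bar R} :=
  mscale (NngNum (ltW r0))
    (measure_function_pushforward__canonical__measure_function_Measure
      lebesgue_measure mr).
suff -> : lebesgue_measure A = nu A.
  by rewrite /nu /= /mscale /= muleA -EFinM mulVf ?mul1e ?gt_eqF.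
apply: lebesgue_measure_unique => //= _ [[a b]] _ <-.
rewrite /mscale /= /pushforward.
rewrite (_ : _ @^-1` _ = `]r^-1 * (a - c), r^-1 * (b - c)]%classic); last first.
  apply/seteqP; split => x /=; rewrite !in_itv /= ![r^-1 * _]mulrC.
    by rewrite ltr_pdivrMr // ler_pdivlMr // ltrBlDr lerBrDr mulrC.
  by rewrite ltr_pdivrMr // ler_pdivlMr // ltrBlDr lerBrDr mulrC.
rewrite !lebesgue_measure_itv /= !lte_fin ltr_pM2l ?invr_gt0 // ltrD2r.
case: ifP => _; last by rewrite mule0.
rewrite -!EFinD -EFinM; congr EFin.
by rewrite -mulrBr mulrA mulfV ?gt_eqF // mul1r; ring.
Qed.

Lemma integral_lebesgue_affine (R : realType) (r c : R) (f : R -> \bar R) :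
  0 < r -> measurable_fun setT f -> (forall x, 0 <= f x)%E ->
  (\int[@lebesgue_measure R]_x f (r * x + c)%R =
   (r^-1)%:E * \int[@lebesgue_measure R]_x f x)%E.
Proof.
move=> r0 mf f0.
have mr : measurable_fun setT
    ((fun x => r * x + c) : measurableTypeR R -> measurableTypeR R).
  by apply: measurable_funD => //; exact: measurable_funM.
have := ge0_integral_pushforward mr lebesgue_measure measurableT mf.
rewrite preimage_setT /= => <- //.
pose k : {nonneg R} := NngNum (etrans (invr_ge0 r) (ltW r0)).
rewrite -(ge0_integral_mscale _ _ k) //.
by apply: eq_measure_integral => A mA _; exact: lebesgue_measure_affine.
Qed.

Lemma integral_lebesgue_opp (R : realType) (f : R -> \bar R) :
  measurable_fun setT f -> (forall x, 0 <= f x)%E ->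
  (\int[@lebesgue_measure R]_x f (- x)%R = \int[@lebesgue_measure R]_x f x)%E.
Proof.
move=> mf f0.
have mN : measurable_fun setT (-%R : measurableTypeR R -> measurableTypeR R).
  exact: oppr_measurable.
have := ge0_integral_pushforward mN lebesgue_measure measurableT mf.
rewrite preimage_setT /= => <- //.
by apply: eq_measure_integral => A mA _; exact: lebesgue_measureN.
Qed.

Definition dilate {R : realType} n (r : R) (x : n.-tuple R) : n.-tuple R :=
  [tuple r * tnth x i | i < n].

Lemma measurable_dilate (R : realType) n (r : R) :
  measurable_fun setT (@dilate R n r).
Proof.
apply/measurable_fun_tnthP => i; rewrite /comp; under eq_fun do rewrite tnth_mktuple.
by apply: measurable_funM => //; exact: measurable_tnth.
Qed.

(** Induction on the dimension: each coordinate contributes one factor [r^-1]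
by the one-dimensional change of variables. *)
Lemma integral_lebesgue_tuple_dilate (R : realType) n (r : R)
    (f : n.-tuple R -> \bar R) : 0 < r ->
  measurable_fun setT f -> (forall x, 0 <= f x)%E ->
  (\int[lebesgue_tuple n]_x f (dilate r x) =
   (r ^- n)%:E * \int[lebesgue_tuple n]_x f x)%E.
Proof.
move=> r0; elim: n f => [|n IH] f mf f0.
  by rewrite !integral_lebesgue_tuple0 expr0 invr1 mul1e tuple0.
have mft : measurable_fun setT (fun z => f (@tcons R n z)).
  by apply: measurableT_comp => //; exact: measurable_tcons.
rewrite integral_lebesgue_tupleS //; last first.
  by apply: measurableT_comp => //; exact: measurable_dilate.
rewrite integral_lebesgue_tupleS //.
under eq_integral => u _.
  under eq_integral => v _.
    rewrite (_ : dilate r (tcons (u, v)) = tcons (r * u, dilate r v)); last first.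
      apply: eq_from_tnth => i; rewrite tnth_mktuple.
      by case: (unliftP ord0 i) => [j|] ->; rewrite ?tnthS //= tnth_mktuple.
    over.
  rewrite (IH (fun v => f (tcons (r * u, v)))) //; last first.
    exact: measurableT_comp mft (pair1_measurable _).
  over.
pose F (u : R) := (\int[lebesgue_tuple n]_v f (tcons (u, v)))%E.
have mF : measurable_fun setT F.
  exact: (measurable_fun_fubini_tonelli_F (fun z => f (@tcons R n z))).
have F0 u : (0 <= F u)%E by apply: integral_ge0.
have mFr : measurable_fun setT (fun u : measurableTypeR R => F (r * u)).
  by apply: (measurableT_comp mF); exact: measurable_funM.
have rn0 : (0 <= (r ^- n)%:E)%E by rewrite lee_fin invr_ge0 exprn_ge0 // ltW.
rewrite (ge0_integralZl lebesgue_measure measurableT mFr (fun u _ => F0 _) rn0).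
under eq_integral do rewrite -(addr0 (r * _)).
rewrite (integral_lebesgue_affine 0 r0 mF F0) muleA -EFinM.
by rewrite -invfM -exprSr.
Qed.

Lemma integral_lebesgue_tuple_prod (R : realType) n (f : 'I_n -> R -> R) :
  (forall i, measurable_fun setT (f i)) -> (forall i x, 0 <= f i x) ->
  (\int[lebesgue_tuple n]_x (\prod_(i < n) f i (tnth x i))%:E =
   \prod_(i < n) \int[@lebesgue_measure R]_u (f i u)%:E)%E.
Proof.
elim: n f => [|n IH] f mf f0.
  by rewrite integral_lebesgue_tuple0 !big_ord0.
have mp m (g : 'I_m -> R -> R) : (forall i, measurable_fun setT (g i)) ->
    measurable_fun setT (fun x : m.-tuple R => (\prod_(i < m) g i (tnth x i))%:E).
  move=> mg; apply/measurable_EFinP; apply: measurable_prod => i _.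
  by apply: measurableT_comp => //; exact: measurable_tnth.
rewrite integral_lebesgue_tupleS; last 2 first.
- exact: mp.
- by move=> x; rewrite lee_fin prodr_ge0.
rewrite big_ord_recl -IH //.
have mf0 : measurable_fun setT (fun u => (f ord0 u)%:E).
  by apply/measurable_EFinP; exact: mf.
rewrite -(ge0_integralZr lebesgue_measure measurableT mf0); last 2 first.
- by move=> u _; rewrite lee_fin.
- by apply: integral_ge0 => u _; rewrite lee_fin prodr_ge0.
apply: eq_integral => u _.
rewrite -(ge0_integralZl (lebesgue_tuple n) measurableT
  (mp _ (fun i => f (lift ord0 i)) _)) ?lee_fin //; last first.
  by move=> x _; rewrite lee_fin prodr_ge0.
apply: eq_integral => v _; rewrite big_ord_recl EFinM; congr (_ * (_)%:E)%E.
by apply: eq_bigr => i _; rewrite tnthS.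
Qed.

(** * Two integrals over the half-line from 1 *)

(** The bound [C / x] on the antiderivative makes its limit at infinity zero. *)
Lemma integral_itv1y_derive (R : realType) (f F : R -> R) (C : R) :
  (forall x, 1 <= x -> 0 <= f x) ->
  (forall x, 1 <= x -> derivable f x 1) ->
  (forall x : R, 1 <= x -> is_derive x 1 F (f x)) ->
  (forall x, 1 <= x -> `|F x| <= C / x) ->
  (\int[lebesgue_measure]_(x in `[1%R, +oo[) (f x)%:E = (- F 1)%:E)%E.
Proof.
move=> f0 df dF Fle.
rewrite (@ge0_continuous_FTC2y _ f F 1 0) //.
- by rewrite sub0e EFinN.
- apply: derivable_within_continuous => x; rewrite in_itv /= andbT; exact: df.
- apply/cvgr0Pnorm_le => e e0; near=> x.
  have x1 : 1 <= x by near: x; apply: nbhs_pinfty_ge; rewrite num_real.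
  have xC : e^-1 * C <= x by near: x; apply: nbhs_pinfty_ge; rewrite num_real.
  have x0 : 0 < x by lra.
  by rewrite (le_trans (Fle _ x1)) // ler_pdivrMr // -ler_pdivrMl.
- by move=> x x1; have := dF x (ltW x1); case.
- apply: cvg_at_right_filter; apply: differentiable_continuous.
  by apply/derivable1_diffP; have [] := dF 1 (lexx 1).
- move=> x; rewrite in_itv /= andbT => /ltW x1.
  by rewrite derive1E; have := dF x x1 => ?; rewrite derive_val.
Unshelve. all: by end_near. Qed.

Lemma integral_itv1y_expV (R : realType) (k : nat) :
  (\int[@lebesgue_measure R]_(x in `[1%R, +oo[) (x ^- k.+2)%:E =
   (k.+1%:R^-1)%:E)%E.
Proof.
pose F (x : R) := - k.+1%:R^-1 * (x ^- k.+1).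
refine (etrans (@integral_itv1y_derive R _ F 1 _ _ _ _) _).
- by move=> x x1; rewrite invr_ge0 exprn_ge0 //; lra.
- move=> x x1; apply: derivableV; last exact: exprn_derivable.
  by rewrite expf_neq0 // gt_eqF //; lra.
- move=> x x1; have x0 : x != 0 by rewrite gt_eqF //; lra.
  have xk : (fun x : R => x ^+ k.+1) x != 0 by rewrite expf_neq0.
  have d1 : is_derive x 1 (fun x : R => x ^+ k.+1) (k.+1%:R * x ^+ k).
    have := is_deriveX k.+1 (is_derive_id x (1 : R)).
    by rewrite exprfctE [_ *: _]mulr1.
  have := is_deriveZ (- k.+1%:R^-1) (@is_deriveV _ (fun x => x ^+ k.+1) x _ _ xk d1).
  move=> H; apply: (is_derive_eq H); rewrite /GRing.scale /=.
  have y0 : x ^+ k != 0 by rewrite expf_neq0.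
  rewrite !exprS expr0; move: (x ^+ k) y0 => y y0.
  have : k.+1%:R != 0 :> R by rewrite pnatr_eq0.
  by move: (k.+1%:R) => c c0; field; rewrite x0 y0 c0.
- move=> x x1; have x0 : 0 < x by lra.
  rewrite /F normrM normrN !ger0_norm ?invr_ge0 ?exprn_ge0 ?(ltW x0) ?ler0n //.
  rewrite ler_pM ?invr_ge0 ?exprn_ge0 ?(ltW x0) // ?invf_le1 ?ler1n ?ltr0n //.
  rewrite lef_pV2 ?posrE ?exprn_gt0 // exprS ler_peMr ?(ltW x0) //.
  by rewrite exprn_ege1.
- by rewrite /F expr1n invr1 mulr1 opprK.
Qed.

(** The decay of the antiderivative comes from [y <= expR y] at
[y = x ^+ 2 * q / 2 >= x * q / 2]. *)
Lemma integral_itv1y_mul_gauss (R : realType) (q : R) : 0 < q ->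
  (\int[@lebesgue_measure R]_(x in `[1%R, +oo[)
     (x * expR (- (x ^+ 2 * q) / 2))%:E = (q^-1 * expR (- q / 2))%:E)%E.
Proof.
move=> q0; pose F (x : R) := - q^-1 * expR (- (x ^+ 2 * q) / 2).
have dE (x : R) : is_derive x 1 (fun x : R => expR (- (x ^+ 2 * q) / 2))
   (expR (- (x ^+ 2 * q) / 2) * (- (x * q))).
  have d1 : is_derive x 1 (fun x : R => - (x ^+ 2 * q) / 2) (- (x * q)).
    have := is_deriveZ (- (q / 2)) (is_deriveX 2 (is_derive_id x (1 : R))).
    rewrite exprfctE.
    rewrite (_ : _ \*: _ = (fun x : R => - (x ^+ 2 * q) / 2)); last first.
      by apply/funext => y /=; rewrite /GRing.scale /=; lra.
    move=> H; apply: (is_derive_eq H); rewrite /GRing.scale /= expr1; by field.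
  exact: is_derive1_comp.
refine (etrans (@integral_itv1y_derive R _ F (2 / q ^+ 2) _ _ _ _) _).
- by move=> x x1; rewrite mulr_ge0 ?expR_ge0 //; apply: le_trans x1.
- move=> x _; have h1 : derivable (@id R) x 1 by exact: derivable_id.
  have h2 := @ex_derive _ _ _ _ _ _ _ (dE x).
  exact: derivableM h1 h2.
- move=> x x1; have := is_deriveZ (- q^-1) (dE x).
  move=> H; apply: (is_derive_eq H); rewrite /GRing.scale /=.
  by field; rewrite gt_eqF.
- move=> x x1; have x0 : 0 < x by lra.
  rewrite /F normrM normrN !ger0_norm ?invr_ge0 ?expR_ge0 ?(ltW q0) //.
  rewrite mulNr expRN.
  have xq : x * q / 2 <= expR (x ^+ 2 * q / 2).
    apply: le_trans (expR_ge1Dx _); rewrite ler_wpDl // ler_pM2r // ler_pM2r //.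
    by rewrite expr2 ler_peMr // ltW.
  have xq0 : 0 < x * q / 2 by rewrite divr_gt0 ?mulr_gt0.
  have -> : 2 / q ^+ 2 / x = q^-1 * (x * q / 2)^-1.
    by field; rewrite !gt_eqF.
  by rewrite ler_pM2l ?invr_gt0 // lef_pV2 ?posrE ?expR_gt0.
- by rewrite /F expr1n mul1r mulNr opprK.
Qed.

(** * Gaussian integrals as superpositions of dilated Gaussians *)

(** On nonnegative reals the inverse is the power of exponent -1, which
is measurable on the whole line. *)
Lemma measurable_inv_ge0 {d} {T : measurableType d} (R : realType) (f : T -> R) :
  measurable_fun setT f -> (forall x, 0 <= f x) ->
  measurable_fun setT (fun x => (f x)^-1).
Proof.
move=> mf f0; under eq_fun do rewrite -(powR_inv1 (f0 _)).
exact: measurableT_comp (measurable_powR _) mf.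
Qed.

Lemma measurable_gauss_shell d (T : measurableType d) (R : realType)
    (Q h : T -> R) :
  measurable_fun setT Q -> measurable_fun setT h ->
  measurable_fun setT (fun z : measurableTypeR R * T =>
    (h z.2 * expR (- (z.1 ^+ 2 * Q z.2) / 2))%:E).
Proof.
move=> mQ mh; apply/measurable_EFinP; apply: measurable_funM.
  exact: measurableT_comp mh (measurable_snd).
apply: measurableT_comp => //; apply: measurable_funM => //.
apply: measurableT_comp => //; apply: measurable_funM.
  by apply: measurable_funX; exact: measurable_fst.
exact: measurableT_comp mQ (measurable_snd).
Qed.

(** For [q > 0], [q^-1 * expR (- q / 2)] is the integral over [r >= 1] of
[r * expR (- (r ^+ 2 * q) / 2)]; take [q = Q x] and exchange the integrals. The
dilation [r] of the Gaussian weight can then be traded for a dilation of the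
variable. *)
Lemma gauss_integral_shells d (T : measurableType d) (R : realType)
    (mu : {sigma_finite_measure set T -> \bar R}) (Q h : T -> R) :
  measurable_fun setT Q -> measurable_fun setT h ->
  (forall x, 0 <= Q x) -> (forall x, 0 <= h x) ->
  (forall x, Q x = 0 -> h x = 0) ->
  (\int[mu]_x (h x / Q x * expR (- Q x / 2))%:E =
   \int[@lebesgue_measure R]_(r in `[1%R, +oo[)
     (r%:E * \int[mu]_x (h x * expR (- (r ^+ 2 * Q x) / 2))%:E))%E.
Proof.
move=> mQ mh Q0 h0 Qh.
pose D : set R := `[1%R, +oo[%classic.
have mD : measurable D by exact: measurable_itv.
have D0 r : D r -> 0 <= r by rewrite /D /= in_itv /= andbT; lra.
(* The domain of r is moved into the integrand, as Tonelli's theorem concerns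
   integrals over whole spaces. *)
pose g (z : measurableTypeR R * T) : \bar R :=
  ((z.1 * \1_D z.1) * (h z.2 * expR (- (z.1 ^+ 2 * Q z.2) / 2)))%:E.
have w0 (r : R) : 0 <= r * \1_D r.
  rewrite indicE; case: (boolP (r \in D)) => [|_]; last by rewrite mulr0.
  by rewrite inE => /D0; rewrite mulr1.
have g0 z : (0 <= g z)%E.
  by rewrite lee_fin; apply: mulr_ge0; [exact: w0|rewrite mulr_ge0 ?expR_ge0].
have mg : measurable_fun setT g.
  apply/measurable_EFinP; apply: measurable_funM.
    apply: measurable_funM; first exact: measurable_fst.
    exact: measurableT_comp (measurable_indic mD) (measurable_fst).
  by apply/measurable_EFinP; exact: measurable_gauss_shell.
have mI r : measurable_fun setT (fun x => (h x * expR (- (r ^+ 2 * Q x) / 2))%:E).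
  exact: (measurableT_comp (measurable_gauss_shell mQ mh) (pair1_measurable r)).
transitivity (\int[@lebesgue_measure R]_r \int[mu]_x g (r, x))%E; last first.
  rewrite [RHS]integral_mkcond; apply: eq_integral => r _.
  rewrite patchE /g /= indicE; case: ifPn => rD; last first.
    by under eq_integral do rewrite mulr0 mul0r; rewrite integral0.
  rewrite -(ge0_integralZl mu measurableT (mI r)) ?lee_fin //.
  - by apply: eq_integral => x _; rewrite mulr1 EFinM.
  - by move=> x _; rewrite lee_fin mulr_ge0 ?expR_ge0.
  - by apply: D0; rewrite inE in rD.
rewrite (fubini_tonelli g mg g0); apply: eq_integral => x _.
transitivity (\int[@lebesgue_measure R]_(r in D)
   ((h x)%:E * (r * expR (- (r ^+ 2 * Q x) / 2))%:E))%E; last first.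
  rewrite integral_mkcond; apply: eq_integral => r _.
  rewrite patchE /g /= indicE; case: ifPn => rD; last by rewrite mulr0 mul0r.
  by rewrite mulr1 mulrCA EFinM.
rewrite ge0_integralZl ?lee_fin //.
- have [/Qh -> |Qn0] := eqVneq (Q x) 0; first by rewrite !mul0r mul0e.
  rewrite integral_itv1y_mul_gauss -?EFinM ?mulrA //.
  by rewrite lt_neqAle eq_sym Qn0 Q0.
- apply/measurable_EFinP; apply: measurable_funM => //.
  apply: measurableT_comp => //; apply: measurable_funM => //.
  by apply: measurableT_comp => //; apply: measurable_funM.
- by move=> r Dr; rewrite lee_fin mulr_ge0 ?expR_ge0 ?D0.
Qed.

(** A one-sided form, for functions nondecreasing along rays, of the fact that
the inverse of a chi-square variable with [n] degrees of freedom has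
expectation [1 / (n - 2)]; here [n = k.+3]. The dilation by [r] yields the
factor [r ^- n] and the shell measure a factor [r], so that the constant is the
integral of [r ^- (n - 1)] over [r >= 1]. *)
Lemma gauss_integral_div_le (R : realType) (k : nat)
    (Q h : (k.+3).-tuple R -> R) :
  measurable_fun setT Q -> measurable_fun setT h ->
  (forall x, 0 <= Q x) -> (forall x, 0 <= h x) ->
  (forall x, Q x = 0 -> h x = 0) ->
  (forall r x, 0 < r -> Q (dilate r x) = r ^+ 2 * Q x) ->
  (forall r x, 1 <= r -> h x <= h (dilate r x)) ->
  (\int[lebesgue_tuple k.+3]_x (h x / Q x * expR (- Q x / 2))%:E <=
   (k.+1%:R^-1)%:E * \int[lebesgue_tuple k.+3]_x (h x * expR (- Q x / 2))%:E)%E.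
Proof.
move=> mQ mh Q0 h0 Qh Qd hd.
rewrite gauss_integral_shells //.
set I := (\int[_]_x (h x * expR (- Q x / 2))%:E)%E.
have mG : measurable_fun setT (fun x => (h x * expR (- Q x / 2))%:E).
  apply/measurable_EFinP; apply: measurable_funM => //.
  apply: measurableT_comp => //; apply: measurable_funM => //.
  exact: measurableT_comp.
have G0 x : (0 <= (h x * expR (- Q x / 2))%:E)%E by rewrite lee_fin mulr_ge0 ?expR_ge0.
have I0 : (0 <= I)%E by apply: integral_ge0.
have mD : measurable (`[1, +oo[%classic : set R) by exact: measurable_itv.
have D1 (r : R) : r \in `[1, +oo[ -> 1 <= r by rewrite in_itv /= andbT.
have mV : measurable_fun (`[1, +oo[%classic : set R) (fun r : R => (r ^- k.+2)%:E).
  apply/measurable_EFinP.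
  apply: (@eq_measurable_fun _ _ _ _ _ (fun r : R => `|r| ^- k.+2)).
    move=> r; rewrite inE => rD; rewrite ger0_norm //.
    by rewrite (le_trans ler01) ?D1.
  apply: measurable_funTS; apply: measurable_inv_ge0 => [|r].
    by apply: measurable_funX; exact: normr_measurable.
  by rewrite exprn_ge0.
have V0 (r : R) : r \in `[1, +oo[ -> (0 <= (r ^- k.+2)%:E)%E.
  by move=> /D1 r1; rewrite lee_fin invr_ge0 exprn_ge0 // (le_trans ler01).
rewrite -integral_itv1y_expV -(ge0_integralZr lebesgue_measure mD mV V0 I0).
apply: ge0_le_integral => //.
- move=> r /D1 r1; apply: mule_ge0; first by rewrite lee_fin (le_trans ler01).
  by apply: integral_ge0 => x _; rewrite lee_fin mulr_ge0 ?expR_ge0.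
- apply: emeasurable_funM => //; apply: measurable_funTS.
  apply: (measurable_fun_fubini_tonelli_F _ (measurable_gauss_shell mQ mh)).
  by move=> z; rewrite lee_fin mulr_ge0 ?expR_ge0.
- by apply: emeasurable_funM.
move=> r /D1 r1; have r0 : 0 < r by apply: lt_le_trans r1.
have -> : r ^- k.+2 = r * r ^- k.+3.
  by rewrite [r ^+ k.+3]exprS (invfM r (r ^+ k.+2)) mulrA mulfV ?mul1r ?gt_eqF.
rewrite EFinM -muleA lee_pmul2l ?lte_fin //.
rewrite -(integral_lebesgue_tuple_dilate r0 mG G0).
apply: ge0_le_integral => //.
- by move=> x _; rewrite lee_fin mulr_ge0 ?expR_ge0.
- exact: (measurableT_comp (measurable_gauss_shell mQ mh) (pair1_measurable r)).
- exact: measurableT_comp mG (measurable_dilate r).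
- by move=> x _; rewrite lee_fin Qd // ler_pM2r ?expR_gt0 // hd.
Qed.

(** * One-dimensional Gaussian densities *)

Section gauss.
Context {R : realType}.
Implicit Types v t m x c : R.

(** The density of N(m, v), parameterized by the variance. *)
Definition gauss v m x : R :=
  (Num.sqrt (2 * pi * v))^-1 * expR (- (x - m) ^+ 2 / (2 * v)).

Lemma gauss_ge0 v m x : 0 <= gauss v m x.
Proof. by rewrite mulr_ge0 ?expR_ge0 ?invr_ge0 ?sqrtr_ge0. Qed.

Lemma measurable_gauss_comp d (T : measurableType d) v (f g : T -> R) :
  measurable_fun setT f -> measurable_fun setT g ->
  measurable_fun setT (fun z => gauss v (f z) (g z)).
Proof.
move=> mf mg; apply: measurable_funM => //; apply: measurableT_comp => //.
apply: measurable_funM => //; apply: measurableT_comp => //.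
by apply: measurable_funX; exact: measurable_funB.
Qed.

Lemma measurable_gauss v m : measurable_fun setT (gauss v m).
Proof. exact: measurable_gauss_comp. Qed.

Lemma integral_gauss v m : 0 < v ->
  (\int[@lebesgue_measure R]_x (gauss v m x)%:E = 1)%E.
Proof.
move=> v0; rewrite -(integral_normal_pdf m (Num.sqrt v)).
apply: eq_integral => x _; rewrite normal_pdfE ?gt_eqF ?sqrtr_gt0 //.
rewrite /gauss /normal_peak /normal_fun sqr_sqrtr ?(ltW v0) //.
by rewrite -mulrA (mulrC pi v) (mulr_natl (v * pi)) (mulr_natl v).
Qed.

Lemma gauss_standardize v m y : 0 < v ->
  gauss v m (Num.sqrt v * y + m) = (Num.sqrt v)^-1 * gauss 1 0 y.
Proof.
move=> v0; rewrite /gauss addrK subr0 exprMn sqr_sqrtr ?(ltW v0) //.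
rewrite sqrtrM ?mulr_ge0 ?pi_ge0 // !mulr1 invfM mulrA (mulrC (_^-1) (_^-1)).
by rewrite (_ : - (v * y ^+ 2) / (2 * v) = - y ^+ 2 / 2) //; field; rewrite gt_eqF.
Qed.

Lemma measurable_affine (r c : R) :
  measurable_fun setT (fun x : R => r * x + c).
Proof. by apply: measurable_funD => //; exact: measurable_funM. Qed.

(** The variance of the standard Gaussian, by the shell identity applied to
[Q x = x ^+ 2] and to a multiple of [x ^+ 2]: the left-hand side is the total
mass, and on the right the dilation by [r] gives [r * r ^- 3], of integral 1. *)
Lemma integral_gauss01_sqr :
  (\int[@lebesgue_measure R]_x (x ^+ 2 * gauss 1 0 x)%:E = 1)%E.
Proof.
set I := (\int[_]_x _)%E; rewrite -(integral_gauss 0 (@ltr01 R)).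
set k := (Num.sqrt (2 * pi * 1 : R))^-1.
have k0 : 0 <= k by rewrite invr_ge0 sqrtr_ge0.
have gE x : gauss 1 0 x = k * expR (- x ^+ 2 / 2) by rewrite /gauss subr0 -/k (mulr1 2).
have mX : measurable_fun setT (fun x : measurableTypeR R => x ^+ 2).
  exact: measurable_funX.
have mkX : measurable_fun setT (fun x : measurableTypeR R => k * x ^+ 2).
  exact: measurable_funM.
have mG : measurable_fun setT (fun x : R => (x ^+ 2 * gauss 1 0 x)%:E).
  apply/measurable_EFinP; apply: measurable_funM => //.
  exact: measurable_gauss.
have G0 (x : R) : (0 <= (x ^+ 2 * gauss 1 0 x)%:E)%E.
  by rewrite lee_fin mulr_ge0 ?sqr_ge0 ?gauss_ge0.
have := @gauss_integral_shells _ _ R (@lebesgue_measure R) _ _ mX mkX.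
move=> /(_ (fun x => sqr_ge0 x) (fun x => mulr_ge0 k0 (sqr_ge0 x))) H.
transitivity (\int[@lebesgue_measure R]_x
  (k * x ^+ 2 / x ^+ 2 * expR (- x ^+ 2 / 2))%:E)%E; last first.
  apply: ae_eq_integral => //.
  - apply/measurable_EFinP; apply: measurable_funM.
      apply: measurable_funM => //.
      by apply: measurable_inv_ge0 => // x; exact: sqr_ge0.
    apply: measurableT_comp => //; apply: measurable_funM => //.
    exact: measurableT_comp.
  - by apply/measurable_EFinP; exact: measurable_gauss.
  (* The quotient of x ^+ 2 by itself is 1 except at x = 0. *)
  exists [set 0]; split => //; first exact: lebesgue_measure_set1.
  move=> x /= /not_implyP[_]; apply: contra_notP => /eqP x0.
  by rewrite gE mulfK // expf_neq0.
rewrite H; last by move=> x ->; rewrite mulr0.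
have I0 : (0 <= I)%E by exact: integral_ge0.
have mD : measurable (`[1, +oo[%classic : set R) by exact: measurable_itv.
have mV : measurable_fun (`[1, +oo[%classic : set R) (fun r : R => (r ^- 2)%:E).
  apply/measurable_EFinP; apply: measurable_funTS.
  by apply: measurable_inv_ge0 => // r; exact: sqr_ge0.
rewrite -[LHS]mul1e -[X in (X%:E * _)%E](invr1) -(@integral_itv1y_expV R 0).
have V0 (r : R) : r \in `[1, +oo[ -> (0 <= (r ^- 2)%:E)%E.
  by move=> _; rewrite lee_fin invr_ge0 sqr_ge0.
rewrite -(ge0_integralZr lebesgue_measure mD mV V0 I0).
apply: eq_integral => r; rewrite inE /= in_itv /= andbT => r1.
have r0 : 0 < r by apply: lt_le_trans r1.
have -> : r ^- 2 = r * r ^- 2 * r^-1 by field; rewrite gt_eqF.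
rewrite EFinM -muleA -(integral_lebesgue_affine 0 r0 mG G0).
rewrite EFinM -muleA; congr (_ * _)%E.
rewrite -ge0_integralZl ?lee_fin ?invr_ge0 ?sqr_ge0 //; last first.
  exact: (measurableT_comp mG (measurable_affine r 0)).
apply: eq_integral => x _; rewrite addr0 -EFinM gE exprMn mulNr; congr EFin.
by field; rewrite gt_eqF.
Qed.

(** After standardization the mean squared error is an integral [J] of
[(a - sqrt v * y) ^+ 2]. The reflection of [y] changes the sign of the cross
term, so that twice [J] involves no cross term; in this way only integrals of
nonnegative functions occur. *)
Lemma integral_gauss_mse v m c : 0 < v ->
  (\int[@lebesgue_measure R]_x ((c - x) ^+ 2 * gauss v m x)%:E =
   ((c - m) ^+ 2 + v)%:E)%E.
Proof.
move=> v0; pose s : R := Num.sqrt v; have s0 : 0 < s by rewrite sqrtr_gt0.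
pose f x := ((c - x) ^+ 2 * gauss v m x)%:E.
have mf : measurable_fun setT f.
  apply/measurable_EFinP; apply: measurable_funM; last exact: measurable_gauss.
  by apply: measurable_funX; exact: measurable_funB.
have f0 x : (0 <= f x)%E by rewrite lee_fin mulr_ge0 ?sqr_ge0 ?gauss_ge0.
pose a := c - m.
pose J (b : R) := (\int[@lebesgue_measure R]_y ((a + b * y) ^+ 2 * gauss 1 0 y)%:E)%E.
have mh (b : R) : measurable_fun setT (fun y : R => ((a + b * y) ^+ 2 * gauss 1 0 y)%:E).
  apply/measurable_EFinP; apply: measurable_funM; last exact: measurable_gauss.
  by apply: measurable_funX; apply: measurable_funD => //; exact: measurable_funM.
have h0 (b y : R) : (0 <= ((a + b * y) ^+ 2 * gauss 1 0 y)%:E)%E.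
  by rewrite lee_fin mulr_ge0 ?sqr_ge0 ?gauss_ge0.
have JE : (\int[@lebesgue_measure R]_x f x)%E = J (- s).
  have s1 : s * s^-1 = 1 by rewrite mulfV // gt_eqF.
  rewrite -[LHS]mul1e -s1 EFinM -muleA -(integral_lebesgue_affine m s0 mf f0).
  rewrite -ge0_integralZl ?lee_fin ?(ltW s0) //; last first.
    exact: (measurableT_comp mf (measurable_affine s m)).
  apply: eq_integral => y _; rewrite -EFinM /f gauss_standardize // -/s; congr EFin.
  by rewrite /a; field; rewrite gt_eqF.
have JN : J (- s) = J s.
  rewrite /J -(integral_lebesgue_opp (mh s) (h0 s)); apply: eq_integral => y _.
  by rewrite /gauss !subr0 sqrrN mulrN mulNr.
have J2 : (J s + J s = (2 * (a ^+ 2 + v))%:E)%E.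
  rewrite -[X in (X + _)%E]JN /J.
  rewrite -ge0_integralD //; [|exact: mh|exact: mh].
  transitivity (\int[@lebesgue_measure R]_y ((2 * a ^+ 2)%:E * (gauss 1 0 y)%:E
     + (2 * v)%:E * (y ^+ 2 * gauss 1 0 y)%:E))%E.
    apply: eq_integral => y _; rewrite -EFinM -EFinM -!EFinD; congr EFin.
    by rewrite -[v in RHS](sqr_sqrtr (ltW v0)) -/s; ring.
  have mg : measurable_fun setT (fun y : measurableTypeR R => (gauss 1 0 y)%:E).
    by apply/measurable_EFinP; exact: measurable_gauss.
  have mg2 : measurable_fun setT (fun y : measurableTypeR R => (y ^+ 2 * gauss 1 0 y)%:E).
    by apply/measurable_EFinP; apply: measurable_funM => //; exact: measurable_gauss.
  have a0 : 0 <= 2 * a ^+ 2 by apply: mulr_ge0; rewrite ?sqr_ge0.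
  have v20 : 0 <= 2 * v by apply: mulr_ge0; rewrite ?(ltW v0).
  have g0 y : (0 <= (gauss 1 0 y)%:E)%E by rewrite lee_fin gauss_ge0.
  have g20 (y : R) : (0 <= (y ^+ 2 * gauss 1 0 y)%:E)%E.
    by rewrite lee_fin; apply: mulr_ge0; rewrite ?sqr_ge0 ?gauss_ge0.
  rewrite (ge0_integralD _ measurableT).
  - rewrite (ge0_integralZl _ measurableT mg (fun y _ => g0 y)) ?lee_fin //.
    rewrite (ge0_integralZl _ measurableT mg2 (fun y _ => g20 y)) ?lee_fin //.
    by rewrite integral_gauss01_sqr integral_gauss // !mule1 -EFinD mulrDr.
  - by move=> y _; apply: mule_ge0; [rewrite lee_fin|exact: g0].
  - exact: measurable_funeM.
  - by move=> y _; apply: mule_ge0; [rewrite lee_fin|exact: g20].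
  - exact: measurable_funeM.
rewrite (_ : (\int[lebesgue_measure]_x _)%E = J s); last by rewrite -JN -JE.
move: J2; case: (J s) => [x| |] //.
by rewrite -EFinD => -[xx]; congr EFin; rewrite -/a; lra.
Qed.

(** Bayes' formula for a Gaussian prior: likelihood times prior equals marginal
times posterior. *)
Lemma gauss_posterior v t th x : 0 < v -> 0 < t ->
  gauss v th x * gauss t 0 th =
  gauss (v + t) 0 x * gauss (v * t / (v + t)) (t / (v + t) * x) th.
Proof.
move=> v0 t0; have vt0 : 0 < v + t by exact: addr_gt0.
have p0 : 0 <= 2 * pi :> R by rewrite mulr_ge0 ?pi_ge0.
rewrite /gauss !subr0 mulrACA [RHS]mulrACA -!expRD -!invfM -!sqrtrM; last 2 first.
- by rewrite mulr_ge0 ?(ltW vt0).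
- by rewrite mulr_ge0 ?(ltW v0).
congr (_^-1 * expR _); first congr Num.sqrt.
  by field; rewrite gt_eqF.
by field; rewrite !gt_eqF.
Qed.

End gauss.

(** * The ensemble risk as a marginal expectation *)

Section bayes.
Context {R : realType} {p : nat}.
Implicit Types (s v m : 'I_p -> R) (x y theta : p.-tuple R) (delta : p.-tuple R -> p.-tuple R).

Definition gausses v m x : R := \prod_(i < p) gauss (v i) (m i) (tnth x i).

Lemma gausses_ge0 v m x : 0 <= gausses v m x.
Proof. by apply: prodr_ge0 => i _; exact: gauss_ge0. Qed.

Lemma gaussesE v m x : (forall i, 0 < v i) ->
  gausses v m x =
  ((2 * pi) `^ (p%:R / 2) * Num.sqrt (\prod_i v i))^-1 *
  expR (- (\sum_i (tnth x i - m i) ^+ 2 / v i) / 2).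
Proof.
move=> v0; rewrite /gausses /gauss big_split /= prodfV -expR_sum.
have p0 : 0 <= 2 * pi :> R by rewrite mulr_ge0 ?pi_ge0.
congr (_^-1 * expR _).
  under eq_bigr do rewrite sqrtrM //.
  rewrite big_split /= prodr_const card_ord; congr (_ * _).
    by rewrite (mulrC _ 2^-1) powRrM powR12_sqrt // powR_mulrn ?sqrtr_ge0.
  apply: (big_rec2 (fun a b => a = Num.sqrt b)) => [|i a b _ ->].
    by rewrite sqrtr1.
  by rewrite sqrtrM // ltW.
rewrite mulNr mulr_suml -sumrN; apply: eq_bigr => i _.
by field; rewrite gt_eqF.
Qed.

Lemma sqnorm_ge0 (w : 'cV[R]_p) : 0 <= sqnorm w.
Proof. by apply: sumr_ge0 => i _; exact: sqr_ge0. Qed.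

Lemma sqnorm_cvecB x y :
  sqnorm (cvec x - cvec y) = \sum_(i < p) (tnth x i - tnth y i) ^+ 2.
Proof. by apply: eq_bigr => i _; rewrite !mxE. Qed.

Lemma quad_diag (d : 'I_p -> R) (w : 'cV[R]_p) :
  (w^T *m diag_mx (\row_i d i) *m w) 0 0 = \sum_i d i * w i 0 ^+ 2.
Proof.
rewrite -mulmxA mul_diag_mx !mxE; apply: eq_bigr => i _.
by rewrite !mxE mulrCA expr2.
Qed.

Lemma invmx_diag (d : 'I_p -> R) : (forall i, d i != 0) ->
  invmx (diag_mx (\row_i d i)) = diag_mx (\row_i (d i)^-1).
Proof.
move=> d0; set A := diag_mx _; set B := diag_mx _.
have AB : A *m B = 1%:M.
  rewrite mulmx_diag -diag_const_mx; congr diag_mx.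
  by apply/rowP => i; rewrite !mxE mulfV.
by have [uA _] := mulmx1_unit AB; rewrite -[LHS]mulmx1 -AB mulKmx.
Qed.

Lemma mvnormal_pdf_diag s theta x : (forall i, 0 < s i) ->
  mvnormal_pdf (cvec theta) (diag_mx (\row_i s i)) (cvec x) =
  gausses s (tnth theta) x.
Proof.
move=> s0; rewrite gaussesE // /mvnormal_pdf det_diag.
rewrite invmx_diag => [|i]; last by rewrite gt_eqF.
rewrite quad_diag; congr ((_ * Num.sqrt _)^-1 * expR (- _ / 2)).
  by apply: eq_bigr => i _; rewrite mxE.
by apply: eq_bigr => i _; rewrite !mxE mulrC.
Qed.

Lemma prior_gausses (tau : R) theta : 0 < tau ->
  ((2 * pi * tau) `^ (p%:R / 2))^-1 * expR (- sqnorm (cvec theta) / (2 * tau))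
  = gausses (fun=> tau) (fun=> 0) theta.
Proof.
move=> t0; rewrite gaussesE // prodr_const card_ord.
have p0 : 0 <= 2 * pi :> R by rewrite mulr_ge0 ?pi_ge0.
congr (_^-1 * expR _).
  rewrite powRM ?(ltW t0) //; congr (_ * _).
  rewrite (mulrC _ 2^-1) powRrM powR12_sqrt ?(ltW t0) // powR_mulrn ?sqrtr_ge0 //.
  elim: p => [|k IH]; first by rewrite !expr0 sqrtr1.
  by rewrite !exprS IH sqrtrM ?(ltW t0).
rewrite /sqnorm !mulNr !mulr_suml; congr (- _); apply: eq_bigr => i _.
by rewrite mxE subr0; field; rewrite gt_eqF.
Qed.

Lemma measurable_gausses d (T : measurableType d) v (m : 'I_p -> T -> R)
    (x : T -> p.-tuple R) :
  (forall i, measurable_fun setT (m i)) -> measurable_fun setT x ->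
  measurable_fun setT (fun z => gausses v (m ^~ z) (x z)).
Proof.
move=> mm mx; apply: measurable_prod => i _.
apply: measurable_gauss_comp => //.
exact: (measurableT_comp (measurable_tnth i) mx).
Qed.

Lemma integral_gausses v m : (forall i, 0 < v i) ->
  (\int[lebesgue_tuple p]_x (gausses v m x)%:E = 1)%E.
Proof.
move=> v0; rewrite (integral_lebesgue_tuple_prod (f := fun i => gauss (v i) (m i))).
- by rewrite big1 // => i _; rewrite integral_gauss.
- by move=> i; exact: measurable_gauss.
- by move=> i x; exact: gauss_ge0.
Qed.

(** Multiplying a product density by a function of one coordinate keeps it a
product, so that the integral factorizes. *)
Lemma integral_gausses_sqr v m i (c : R) : (forall i, 0 < v i) ->
  (\int[lebesgue_tuple p]_x ((c - tnth x i) ^+ 2 * gausses v m x)%:E =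
   ((c - m i) ^+ 2 + v i)%:E)%E.
Proof.
move=> v0.
pose f j (y : R) := (if j == i then (c - y) ^+ 2 else 1) * gauss (v j) (m j) y.
transitivity (\int[lebesgue_tuple p]_x (\prod_(j < p) f j (tnth x j))%:E)%E.
  apply: eq_integral => x _; rewrite /f big_split /= -big_mkcond /=.
  by rewrite big_pred1_eq.
rewrite (integral_lebesgue_tuple_prod (f := f)); last 2 first.
- move=> j; apply: measurable_funM; last exact: measurable_gauss.
  by case: eqP => // _; apply: measurable_funX; exact: measurable_funB.
- move=> j x; rewrite /f; apply: mulr_ge0; rewrite ?gauss_ge0 //.
  by case: eqP => // _; exact: sqr_ge0.
rewrite (bigD1 i) //= big1 ?mule1.
  by rewrite /f eqxx integral_gauss_mse.
move=> j /negbTE ji; rewrite /f ji.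
by under eq_integral do rewrite mul1r; rewrite integral_gauss.
Qed.

Lemma integral_gausses_sqnorm v m y : (forall i, 0 < v i) ->
  (\int[lebesgue_tuple p]_x (sqnorm (cvec y - cvec x) * gausses v m x)%:E =
   (\sum_i ((tnth y i - m i) ^+ 2 + v i))%:E)%E.
Proof.
move=> v0; under eq_integral do rewrite sqnorm_cvecB mulr_suml -sumEFin.
rewrite ge0_integral_sum //.
- rewrite -sumEFin; apply: eq_bigr => i _; exact: integral_gausses_sqr.
- move=> i; apply/measurable_EFinP; apply: measurable_funM.
    apply: measurable_funX; apply: measurable_funB => //; exact: measurable_tnth.
  exact: measurable_gausses.
- by move=> i x _; rewrite lee_fin mulr_ge0 ?sqr_ge0 ?gausses_ge0.
Qed.

(** Tonelli's theorem puts the integral over [theta] inside; there the product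
of likelihood and prior is the marginal density of [x] times the posterior
density of [theta], under which the expected squared error splits into squared
bias and variance. *)
Lemma ensemble_risk_posterior s delta (tau : R) :
  (forall i, 0 < s i) -> 0 < tau -> estimator delta ->
  let b i := tau / (s i + tau) in
  let v i := s i * tau / (s i + tau) in
  ensemble_risk (diag_mx (\row_i s i)) delta tau =
  (\int[lebesgue_tuple p]_x
    ((\sum_i ((tnth (delta x) i - b i * tnth x i) ^+ 2 + v i)) *
     gausses (fun i => s i + tau) (fun=> 0) x)%:E)%E.
Proof.
move=> s0 t0 mdelta b v.
have v0 i : 0 < v i by rewrite divr_gt0 ?mulr_gt0 ?addr_gt0.
pose g (z : p.-tuple R * p.-tuple R) : R :=
  sqnorm (cvec (delta z.2) - cvec z.1) *
  (gausses s (tnth z.1) z.2 * gausses (fun=> tau) (fun=> 0) z.1).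
have g0 z : 0 <= g z.
  rewrite mulr_ge0 ?mulr_ge0 ?gausses_ge0 //.
  exact: sqnorm_ge0.
have mg : measurable_fun setT (fun z => (g z)%:E).
  apply/measurable_EFinP; apply: measurable_funM.
    under eq_fun do rewrite sqnorm_cvecB.
    apply: measurable_sum => i; apply: measurable_funX; apply: measurable_funB.
      apply: (measurableT_comp (measurable_tnth i)).
      exact: (measurableT_comp mdelta measurable_snd).
    exact: (measurableT_comp (measurable_tnth i) measurable_fst).
  apply: measurable_funM; apply: measurable_gausses => //.
  by move=> i; exact: (measurableT_comp (measurable_tnth i) measurable_fst).
transitivity (\int[lebesgue_tuple p]_th \int[lebesgue_tuple p]_x (g (th, x))%:E)%E.
  apply: eq_integral => th _; rewrite prior_gausses // /risk.
  rewrite -ge0_integralZr ?lee_fin ?gausses_ge0 //.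
  - by apply: eq_integral => x _; rewrite mvnormal_pdf_diag // -EFinM /g mulrA.
  - apply/measurable_EFinP; apply: measurable_funM; last first.
      under eq_fun do rewrite mvnormal_pdf_diag //.
      exact: measurable_gausses.
    under eq_fun do rewrite sqnorm_cvecB.
    apply: measurable_sum => i; apply: measurable_funX; apply: measurable_funB => //.
    exact: (measurableT_comp (measurable_tnth i) mdelta).
  - move=> x _; rewrite mvnormal_pdf_diag // lee_fin.
    by apply: mulr_ge0; [exact: sqnorm_ge0|exact: gausses_ge0].
rewrite (fubini_tonelli _ mg) //; apply: eq_integral => x _.
transitivity (\int[lebesgue_tuple p]_th
  ((gausses (fun i => s i + tau) (fun=> 0) x)%:E *
   (sqnorm (cvec (delta x) - cvec th) *
    gausses v (fun i => b i * tnth x i) th)%:E))%E.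
  apply: eq_integral => th _; rewrite -EFinM /g /= (mulrCA (gausses _ _ x)).
  congr (_ * _)%:E.
  rewrite /gausses -!big_split /=; apply: eq_bigr => i _.
  exact: gauss_posterior.
rewrite ge0_integralZl ?lee_fin ?gausses_ge0 //.
- by rewrite integral_gausses_sqnorm // -EFinM mulrC.
- apply/measurable_EFinP; apply: measurable_funM; last exact: measurable_gausses.
  under eq_fun do rewrite sqnorm_cvecB.
  apply: measurable_sum => i; apply: measurable_funX; apply: measurable_funB => //.
  exact: measurable_tnth.
- move=> th _; rewrite lee_fin.
  by apply: mulr_ge0; [exact: sqnorm_ge0|exact: gausses_ge0].
Qed.

End bayes.

(** * Tangents of concave functions, minima and maxima *)

Section concave.
Context {R : realType} (phi : R -> R).
Hypothesis phi_concave : convex_function (`[0, +oo[ : set R^o) (fun z => - phi z).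
Hypothesis phi_nondecr : forall y z : R, 0 <= y -> y <= z -> phi y <= phi z.

Lemma concave_slopes (y z w : R) : 0 <= y -> y < z -> z < w ->
  (phi w - phi z) * (z - y) <= (phi z - phi y) * (w - z).
Proof.
move=> y0 yz zw.
(* The weight for which z is the barycenter t * y + (1 - t) * w. *)
pose t := (w - z) / (w - y).
have wy : 0 < w - y by lra.
have t0 : 0 <= t by rewrite divr_ge0; lra.
have t1 : t <= 1 by rewrite ler_pdivrMr // mul1r; lra.
have yD : y \in (`[0, +oo[%classic : set R) by rewrite inE /= in_itv /= andbT.
have wD : w \in (`[0, +oo[%classic : set R).
  by rewrite inE /= in_itv /= andbT; lra.
have : - phi (t * y + (1 - t) * w) <= t * - phi y + (1 - t) * - phi w.
  exact: (phi_concave (Itv01 t0 t1) yD wD).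
have -> : t * y + (1 - t) * w = z by rewrite /t; field; rewrite gt_eqF.
have -> : t * - phi y + (1 - t) * - phi w =
  - ((w - z) * phi y + (z - y) * phi w) / (w - y).
  by rewrite /t; field; rewrite gt_eqF.
rewrite ler_pdivlMr //; lra.
Qed.

(** The slope is the supremum of the slopes of the chords to the right of [z0],
which are bounded by every slope of a chord to the left. *)
Lemma concave_tangent (z0 : R) : 0 < z0 -> exists2 m : R, 0 <= m &
  forall w, 0 <= w -> phi w <= phi z0 + m * (w - z0).
Proof.
move=> z00.
pose S : set R := [set (phi w - phi z0) / (w - z0) | w in [set w | z0 < w]].
have Sub y : 0 <= y -> y < z0 -> ubound S ((phi z0 - phi y) / (z0 - y)).
  move=> y0 yz _ [w /= zw <-].
  rewrite ler_pdivrMr ?subr_gt0 // mulrAC ler_pdivlMr ?subr_gt0 //.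
  exact: concave_slopes.
have S0 : S !=set0 by exists ((phi (z0 + 1) - phi z0) / (z0 + 1 - z0)), (z0 + 1) => //=; lra.
have Sb : has_ubound S by exists ((phi z0 - phi 0) / (z0 - 0)); exact: Sub.
have Sle w : z0 < w -> (phi w - phi z0) / (w - z0) <= sup S.
  by move=> zw; apply: ub_le_sup => //; exists w.
exists (sup S).
  apply: le_trans (Sle (z0 + 1) _); last by lra.
  by rewrite divr_ge0 // ?subr_ge0; [apply: phi_nondecr|]; lra.
move=> w w0; have [wz|zw|->] := ltgtP w z0.
- have := ge_sup S0 (Sub _ w0 wz).
  rewrite ler_pdivlMr ?subr_gt0 //; lra.
- by have := Sle _ zw; rewrite ler_pdivrMr ?subr_gt0 //; lra.
- lra.
Qed.

End concave.

Lemma fmin_le (R : realType) p (F : 'I_p -> R) i : fmin F <= F i.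
Proof. by case: p F i => [|p] F i; [case: i|exact: bigmin_le]. Qed.

Lemma le_fmax (R : realType) p (F : 'I_p -> R) i : F i <= fmax F.
Proof. by case: p F i => [|p] F i; [case: i|exact: le_bigmax]. Qed.

Lemma le_fmin (R : realType) p (F : 'I_p.+1 -> R) x :
  (forall i, x <= F i) -> x <= fmin F.
Proof. by move=> H; apply/bigmin_geP; split. Qed.

Lemma lt_fmin (R : realType) p (F : 'I_p.+1 -> R) x :
  (forall i, x < F i) -> x < fmin F.
Proof. by move=> H; apply/bigmin_gtP; split. Qed.


(** * The key inequality for product Gaussians *)

Section wsq.
Context {R : realType} {p : nat}.
Implicit Types (d : 'I_p -> R) (x : p.-tuple R).

(** The diagonal quadratic form with coefficients [d]. *)
Definition wsq d x : R := \sum_(i < p) d i * tnth x i ^+ 2.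

Lemma wsq_ge0 d x : (forall i, 0 <= d i) -> 0 <= wsq d x.
Proof. by move=> d0; apply: sumr_ge0 => i _; rewrite mulr_ge0 ?sqr_ge0. Qed.

Lemma wsq_ge d x i : (forall i, 0 <= d i) -> d i * tnth x i ^+ 2 <= wsq d x.
Proof.
move=> d0; rewrite /wsq (bigD1 i) //= lerDl sumr_ge0 // => j _.
by rewrite mulr_ge0 ?sqr_ge0.
Qed.

Lemma wsq_eq0 d x i : (forall i, 0 < d i) -> wsq d x = 0 -> tnth x i = 0.
Proof.
move=> d0 z0; have := @wsq_ge d x i (fun j => ltW (d0 j)).
rewrite z0 pmulr_rle0 // => x2; apply/eqP.
by rewrite -sqrf_eq0 eq_le x2 sqr_ge0.
Qed.

Lemma wsq_dilate d r x : wsq d (dilate r x) = r ^+ 2 * wsq d x.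
Proof.
rewrite /wsq mulr_sumr; apply: eq_bigr => i _.
by rewrite tnth_mktuple exprMn mulrCA.
Qed.

Lemma measurable_wsq d : measurable_fun setT (wsq d).
Proof.
apply: measurable_sum => i; apply: measurable_funM => //.
by apply: measurable_funX; exact: measurable_tnth.
Qed.

End wsq.

(** [gauss_integral_div_le] for the normalized density, the normalizing constant
being absorbed into [h]. *)
Lemma gausses_div_wsq_le (R : realType) (k : nat) (D : 'I_k.+3 -> R)
    (h : (k.+3).-tuple R -> R) :
  (forall i, 0 < D i) -> measurable_fun setT h -> (forall x, 0 <= h x) ->
  (forall x, wsq (fun i => (D i)^-1) x = 0 -> h x = 0) ->
  (forall r x, 1 <= r -> h x <= h (dilate r x)) ->
  (\int[lebesgue_tuple k.+3]_x
     (h x / wsq (fun i => (D i)^-1) x * gausses D (fun=> 0) x)%:E <=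
   (k.+1%:R^-1)%:E *
     \int[lebesgue_tuple k.+3]_x (h x * gausses D (fun=> 0) x)%:E)%E.
Proof.
move=> D0 mh h0 hQ hd; set Q := wsq _.
pose K := ((2 * pi) `^ (k.+3%:R / 2) * Num.sqrt (\prod_i D i))^-1 : R.
have K0 : 0 <= K by rewrite invr_ge0 mulr_ge0 ?powR_ge0 ?sqrtr_ge0.
have gE x : gausses D (fun=> 0) x = K * expR (- Q x / 2).
  rewrite gaussesE // -/K; congr (_ * expR (- _ / 2)).
  by apply: eq_bigr => i _; rewrite subr0 mulrC.
have mQ : measurable_fun setT Q by exact: measurable_wsq.
have := @gauss_integral_div_le R k Q (fun x => K * h x) mQ.
move=> /(_ (measurable_funM (measurable_cst K) mh)) H.
apply: le_trans (le_trans (H _ _ _ _ _) _) => {H} //.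
- by under eq_integral do rewrite gE mulrCA !mulrA.
- by move=> x; apply: wsq_ge0 => i; rewrite invr_ge0 ltW.
- by move=> x; rewrite mulr_ge0.
- by move=> x /hQ ->; rewrite mulr0.
- by move=> r x _; exact: wsq_dilate.
- by move=> r x r1; rewrite ler_wpM2l // hd.
- by under eq_integral do rewrite (mulrC K) -mulrA -gE.
Qed.

(** * The risk of the shrinkage estimator *)

Section shrinkage.
Context {R : realType} {k : nat}.
Let p := k.+3.
Variables (s g : 'I_p -> R) (phi : R -> R) (tau : R).
Hypothesis s0 : forall i, 0 < s i.
Hypothesis g0 : forall i, 0 < g i.
Hypothesis tau0 : 0 < tau.
Hypothesis phi_ge0 : forall z : R, 0 <= z -> 0 <= phi z.
Hypothesis phi_nondecr : forall y z : R, 0 <= y -> y <= z -> phi y <= phi z.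
Hypothesis phi_concave : convex_function (`[0, +oo[ : set R^o) (fun z => - phi z).
Hypothesis phi_div : forall y z : R, 0 < y -> y <= z -> phi z / z <= phi y / y.

(** The statistic z on which the amount of shrinkage depends. *)
Definition scaled_sqnorm : p.-tuple R -> R := wsq (fun i => g i / s i).
Definition shrink x : R := phi (scaled_sqnorm x) / scaled_sqnorm x.

Let D i := s i + tau.
Let a i := g i * (1 + tau / s i).
Let Q : p.-tuple R -> R := wsq (fun i => (D i)^-1).
Let M : p.-tuple R -> R := gausses D (fun=> 0).

Let D0 i : 0 < D i. Proof. exact: addr_gt0. Qed.
Let a0 i : 0 < a i. Proof. by rewrite mulr_gt0 // addr_gt0 // divr_gt0. Qed.
Let M0 x : 0 <= M x. Proof. exact: gausses_ge0. Qed.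

Let gs0 i : 0 < g i / s i. Proof. exact: divr_gt0. Qed.

Lemma scaled_sqnorm_ge0 x : 0 <= scaled_sqnorm x.
Proof. by apply: wsq_ge0 => i; exact: ltW. Qed.

Lemma shrink_ge0 x : 0 <= shrink x.
Proof. by rewrite divr_ge0 ?phi_ge0 // scaled_sqnorm_ge0. Qed.

Lemma measurable_shrink : measurable_fun setT shrink.
Proof.
have mr : measurable_fun setT scaled_sqnorm by exact: measurable_wsq.
apply: measurable_funM; last first.
  by apply: measurable_inv_ge0 => // x; exact: scaled_sqnorm_ge0.
(* phi is monotone only on the nonnegative reals; its composition with the
   maximum with 0 is monotone everywhere. *)
rewrite (_ : (fun x => _) = (fun y => phi (Num.max 0 y)) \o scaled_sqnorm); last first.
  by apply/funext => x /=; rewrite max_r // scaled_sqnorm_ge0.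
apply: measurableT_comp => //; apply: nondecreasing_measurable => //.
move=> y z yz; apply: phi_nondecr; first by rewrite le_max lexx.
by rewrite ge_max le_max lexx /= le_max yz orbT.
Qed.

(** The function h of the key inequality. *)
Definition shrink_sqr i (x : p.-tuple R) := shrink x * tnth x i ^+ 2.

Lemma shrink_sqr_ge0 i x : 0 <= shrink_sqr i x.
Proof. by rewrite mulr_ge0 ?sqr_ge0 ?shrink_ge0. Qed.

Lemma measurable_shrink_sqr i : measurable_fun setT (shrink_sqr i).
Proof.
apply: measurable_funM; first exact: measurable_shrink.
by apply: measurable_funX; exact: measurable_tnth.
Qed.

(** The dilation factors of [x_i ^+ 2] and of the denominator of [shrink]
cancel, leaving the monotonicity of [phi]. *)
Lemma shrink_sqr_dilate i (r : R) x : 1 <= r -> shrink_sqr i x <= shrink_sqr i (dilate r x).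
Proof.
move=> r1; have r0 : 0 < r by lra.
rewrite /shrink_sqr /shrink /scaled_sqnorm wsq_dilate tnth_mktuple -/(scaled_sqnorm _).
have -> : phi (r ^+ 2 * scaled_sqnorm x) / (r ^+ 2 * scaled_sqnorm x) * (r * tnth x i) ^+ 2 =
    phi (r ^+ 2 * scaled_sqnorm x) / scaled_sqnorm x * tnth x i ^+ 2.
  rewrite invfM; move: (phi _) (scaled_sqnorm x)^-1 => u v.
  by field; rewrite gt_eqF.
rewrite ler_wpM2r ?sqr_ge0 // ler_wpM2r ?invr_ge0 ?scaled_sqnorm_ge0 //.
apply: phi_nondecr; first exact: scaled_sqnorm_ge0.
by rewrite ler_peMl ?scaled_sqnorm_ge0 // exprn_ege1.
Qed.

Let Q0 x : Q x = 0 -> forall i, tnth x i = 0.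
Proof. by move=> Qx i; apply: wsq_eq0 Qx => j; rewrite invr_gt0. Qed.

Lemma scaled_sqnormE x : scaled_sqnorm x = \sum_i a i * ((D i)^-1 * tnth x i ^+ 2).
Proof.
apply: eq_bigr => i _; rewrite [RHS]mulrA; congr (_ * _).
by rewrite /a /D; field; rewrite !gt_eqF // addr_gt0.
Qed.

Lemma fmin_scaled_sqnorm_le x : fmin a * Q x <= scaled_sqnorm x.
Proof.
rewrite scaled_sqnormE /Q /wsq mulr_sumr; apply: ler_sum => i _.
by rewrite ler_wpM2r ?fmin_le // mulr_ge0 ?sqr_ge0 // invr_ge0 ltW.
Qed.

Let A0 : 0 < fmin a. Proof. exact: lt_fmin. Qed.

(** The quotient [shrink] is bounded by its value at the smaller argument
[fmin a * Q x], where [phi] lies below its tangent at [p * fmin a]. The result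
is affine in the inverse of [Q], the form to which the key inequality
applies. *)
Lemma scaled_shrink_le (m : R) : 0 <= m ->
  (forall w, 0 <= w -> phi w <= phi (p%:R * fmin a) + m * (w - p%:R * fmin a)) ->
  forall i x, Q x != 0 ->
  a i * shrink x <=
  (fmax a / fmin a) * (phi (p%:R * fmin a) - m * (p%:R * fmin a)) / Q x + fmax a * m.
Proof.
move=> m0 tan i x Qn0.
have Qx : 0 < Q x.
  by rewrite lt_neqAle eq_sym Qn0 wsq_ge0 // => j; rewrite invr_ge0 ltW.
have AQ : 0 < fmin a * Q x by rewrite mulr_gt0.
have amax0 : 0 < fmax a by apply: lt_le_trans (le_fmax a ord0).
apply: (@le_trans _ _ (fmax a * (phi (fmin a * Q x) / (fmin a * Q x)))).
  apply: ler_pM; rewrite ?(ltW (a0 i)) ?shrink_ge0 ?le_fmax //.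
  by apply: phi_div => //; exact: fmin_scaled_sqnorm_le.
have := tan _ (ltW AQ); set P := phi (p%:R * _); set T := p%:R * _ => H.
have -> : fmax a / fmin a * (P - m * T) / Q x + fmax a * m =
    fmax a * ((P + m * (fmin a * Q x - T)) / (fmin a * Q x)).
  by field; rewrite !gt_eqF.
by rewrite ler_pM2l // ler_pM2r // invr_gt0.
Qed.

Hypothesis phi_bound : phi (p%:R * fmin a) <= 2 * (p%:R - 2) * (fmin a / fmax a).

(** With the bound of [scaled_shrink_le], the key inequality leaves a numerical
inequality between the coefficients, which is where the assumption on [phi] at
[p * fmin a] enters. *)
Lemma integral_shrink_contraction i :
  (\int[lebesgue_tuple p]_x (a i * shrink x * shrink_sqr i x * M x)%:E <=
   2%:E * \int[lebesgue_tuple p]_x (shrink_sqr i x * M x)%:E)%E.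
Proof.
have pA0 : 0 < p%:R * fmin a by rewrite mulr_gt0.
have [m m0 tan] := concave_tangent phi_concave phi_nondecr pA0.
have amax0 : 0 < fmax a by apply: lt_le_trans (le_fmax a ord0).
set P := phi (p%:R * fmin a) in tan.
have bP : P <= 2 * (p%:R - 2) * (fmin a / fmax a) by exact: phi_bound.
pose al := (fmax a / fmin a) * (P - m * (p%:R * fmin a)).
(* The tangent at p * fmin a lies above phi, hence above 0, at the origin. *)
have al0 : 0 <= al.
  rewrite mulr_ge0 ?divr_ge0 ?(ltW A0) ?(ltW amax0) //.
  have := tan 0 (lexx 0); rewrite sub0r => H.
  by have := phi_ge0 (lexx 0); lra.
have ga0 : 0 <= fmax a * m by rewrite mulr_ge0 ?(ltW amax0).
have mM : measurable_fun setT M by exact: measurable_gausses.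
have mQ : measurable_fun setT Q by exact: measurable_wsq.
have Qge0 x : 0 <= Q x by apply: wsq_ge0 => j; rewrite invr_ge0 ltW.
have mh := measurable_shrink_sqr i.
have mh1 : measurable_fun setT (fun x => (shrink_sqr i x / Q x * M x)%:E).
  apply/measurable_EFinP; apply: measurable_funM => //; apply: measurable_funM => //.
  exact: measurable_inv_ge0.
have mh2 : measurable_fun setT (fun x => (shrink_sqr i x * M x)%:E).
  by apply/measurable_EFinP; apply: measurable_funM.
have h10 x : (0 <= (shrink_sqr i x / Q x * M x)%:E)%E.
  by rewrite lee_fin mulr_ge0 // divr_ge0 // shrink_sqr_ge0.
have h20 x : (0 <= (shrink_sqr i x * M x)%:E)%E.
  by rewrite lee_fin mulr_ge0 // shrink_sqr_ge0.
have I20 : (0 <= \int[lebesgue_tuple p]_x (shrink_sqr i x * M x)%:E)%E.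
  exact: integral_ge0.
apply: (@le_trans _ _ (\int[lebesgue_tuple p]_x
   (al%:E * (shrink_sqr i x / Q x * M x)%:E + (fmax a * m)%:E * (shrink_sqr i x * M x)%:E))%E).
  apply: ge0_le_integral => //.
  - move=> x _; rewrite lee_fin mulr_ge0 // mulr_ge0 ?shrink_sqr_ge0 //.
    by rewrite mulr_ge0 ?shrink_ge0 // ltW.
  - apply/measurable_EFinP; apply: measurable_funM => //; apply: measurable_funM => //.
    by apply: measurable_funM => //; exact: measurable_shrink.
  - by apply: emeasurable_funD; exact: measurable_funeM.
  - move=> x _; rewrite -!EFinM -EFinD lee_fin.
    have H : a i * shrink x * shrink_sqr i x <=
        (al / Q x + fmax a * m) * shrink_sqr i x.
      have [Q00|Qn0] := eqVneq (Q x) 0.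
        have -> : shrink_sqr i x = 0 by rewrite /shrink_sqr (Q0 Q00 i) expr0n /= mulr0.
        by rewrite !mulr0.
      by rewrite ler_wpM2r ?shrink_sqr_ge0 //; exact: scaled_shrink_le.
    apply: le_trans (ler_wpM2r (M0 x) H) _.
    by move: (shrink_sqr i x) (Q x) => e q; rewrite !mulrDl !mulrA (mulrAC al).
rewrite ge0_integralD //; last 4 first.
- by move=> x _; rewrite mule_ge0.
- exact: measurable_funeM.
- by move=> x _; rewrite mule_ge0.
- exact: measurable_funeM.
rewrite !ge0_integralZl ?lee_fin //.
(* The tangent contributes beta - beta * p / (p - 2), which is nonpositive. *)
have key : al / k.+1%:R + fmax a * m <= 2.
  rewrite -lerBrDr ler_pdivrMr ?ltr0n //.
  have pE : p%:R = k.+1%:R + 2 :> R by rewrite -natrD addn2.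
  have alE : al = fmax a / fmin a * P - fmax a * m * (k.+1%:R + 2).
    by rewrite /al pE; field; rewrite gt_eqF.
  have cP : fmax a / fmin a * P <= 2 * k.+1%:R.
    rewrite pE addrK in bP.
    rewrite mulrC -ler_pdivlMr ?divr_gt0 //; apply: le_trans bP _.
    by rewrite invf_div.
  rewrite alE; lra.
set I := (\int[lebesgue_tuple p]_x (shrink_sqr i x * M x)%:E)%E.
apply: (@le_trans _ _ ((al / k.+1%:R)%:E * I + (fmax a * m)%:E * I)%E).
  apply: leeD2r; rewrite (EFinM al) -muleA; apply: lee_wpmul2l; rewrite ?lee_fin //.
  apply: gausses_div_wsq_le => //.
  - exact: shrink_sqr_ge0.
  - by move=> x Qx; rewrite /shrink_sqr (Q0 Qx i) expr0n /= mulr0.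
  - by move=> r x; exact: shrink_sqr_dilate.
rewrite -ge0_muleDl ?lee_fin ?divr_ge0 // -EFinD.
by apply: lee_wpmul2r => //; rewrite lee_fin.
Qed.

Variable B : R.
Hypothesis phi_le : forall z : R, 0 <= z -> phi z <= B.

Lemma shrink_sqr_le i x : shrink_sqr i x <= B * (s i / g i).
Proof.
have B0 : 0 <= B by apply: le_trans (phi_ge0 (lexx 0)) (phi_le (lexx 0)).
have sg0 : 0 < s i / g i by exact: divr_gt0.
have xz : tnth x i ^+ 2 <= scaled_sqnorm x * (s i / g i).
  rewrite -ler_pdivrMr // invf_div mulrC.
  by apply: (@wsq_ge _ _ (fun i => g i / s i)) => j; exact: ltW.
have [z0|zn0] := eqVneq (scaled_sqnorm x) 0.
  by rewrite /shrink_sqr /shrink z0 invr0 mulr0 mul0r mulr_ge0 // ltW.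
have zp : 0 < scaled_sqnorm x by rewrite lt_neqAle eq_sym zn0 scaled_sqnorm_ge0.
apply: le_trans (ler_wpM2l (shrink_ge0 x) xz) _.
have -> : shrink x * (scaled_sqnorm x * (s i / g i)) = phi (scaled_sqnorm x) * (s i / g i).
  by rewrite /shrink mulrA divfK.
by apply: ler_wpM2r; [exact: ltW|apply: phi_le; exact: ltW].
Qed.

(** Finiteness allows the term [2 * c * I] to be cancelled in
[integral_coordinate_loss_le]. *)
Lemma integral_shrink_sqr_lty i :
  (\int[lebesgue_tuple p]_x (shrink_sqr i x * M x)%:E < +oo)%E.
Proof.
have B0 : 0 <= B * (s i / g i).
  by apply: le_trans (shrink_sqr_ge0 i [tuple 0 | _ < p]) (shrink_sqr_le _ _).
have mM : measurable_fun setT M by exact: measurable_gausses.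
apply: (@le_lt_trans _ _ (\int[lebesgue_tuple p]_x ((B * (s i / g i))%:E * (M x)%:E))%E).
  apply: ge0_le_integral => //.
  - by move=> x _; rewrite lee_fin mulr_ge0 ?shrink_sqr_ge0.
  - by apply/measurable_EFinP; apply: measurable_funM => //; exact: measurable_shrink_sqr.
  - by apply: measurable_funeM; exact/measurable_EFinP.
  - by move=> x _; rewrite -EFinM lee_fin ler_wpM2r // shrink_sqr_le.
rewrite ge0_integralZl ?lee_fin //.
- by rewrite integral_gausses // mule1 ltry.
- exact/measurable_EFinP.
- by move=> x _; rewrite lee_fin.
Qed.

(** With r = s_i / (s_i + tau) and u = [shrink], the loss of coordinate [i] is
r^2 x_i^2 - 2 g_i r u x_i^2 + g_i^2 u^2 x_i^2 plus the posterior variance. The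
first term has expectation s_i^2 / (s_i + tau), which adds up with the variance
to [s i]; the others have a nonpositive sum by [integral_shrink_contraction].
The negative term is moved to the other side, where it is cancelled at the
end. *)
Lemma integral_coordinate_loss_le i :
  (\int[lebesgue_tuple p]_x
     ((((1 - g i * shrink x) * tnth x i - tau / (s i + tau) * tnth x i) ^+ 2
       + s i * tau / (s i + tau)) * M x)%:E <= (s i)%:E)%E.
Proof.
have mM : measurable_fun setT M by exact: measurable_gausses.
have mu := measurable_shrink.
have mx : measurable_fun setT (fun x : p.-tuple R => tnth x i) by exact: measurable_tnth.
have mh := measurable_shrink_sqr i.
pose r := s i / D i; pose c := g i * r.
have r0 : 0 < r by exact: divr_gt0.
have c0 : 0 < c by exact: mulr_gt0.
pose f (x : p.-tuple R) := ((1 - g i * shrink x) * tnth x i -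
  tau / (s i + tau) * tnth x i) ^+ 2 + s i * tau / (s i + tau).
have f0 x : 0 <= f x.
  by rewrite addr_ge0 ?sqr_ge0 // divr_ge0 ?mulr_ge0 ?ltW // addr_gt0.
have mf : measurable_fun setT f.
  apply: measurable_funD => //; apply: measurable_funX; apply: measurable_funB.
    apply: measurable_funM => //; apply: measurable_funB => //.
    exact: measurable_funM.
  exact: measurable_funM.
have fE x : f x * M x + 2 * c * (shrink_sqr i x * M x) =
    r ^+ 2 * ((0 - tnth x i) ^+ 2 * M x) + s i * tau / D i * M x +
    c * (a i * shrink x * shrink_sqr i x * M x).
  rewrite /f /c /r /shrink_sqr /a /D; move: (shrink x) (tnth x i) (M x) => u y w.
  by field; rewrite !gt_eqF // addr_gt0.
have mfM : measurable_fun setT (fun x => (f x * M x)%:E).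
  by apply/measurable_EFinP; exact: measurable_funM.
have mhM : measurable_fun setT (fun x => (shrink_sqr i x * M x)%:E).
  by apply/measurable_EFinP; exact: measurable_funM.
have maM : measurable_fun setT (fun x => (a i * shrink x * shrink_sqr i x * M x)%:E).
  apply/measurable_EFinP; apply: measurable_funM => //; apply: measurable_funM => //.
  exact: measurable_funM.
have mxM : measurable_fun setT (fun x : p.-tuple R => ((0 - tnth x i) ^+ 2 * M x)%:E).
  apply/measurable_EFinP; apply: measurable_funM => //; apply: measurable_funX.
  exact: measurable_funB.
have mME : measurable_fun setT (fun x => (M x)%:E) by apply/measurable_EFinP.
have fM0 x : (0 <= (f x * M x)%:E)%E by rewrite lee_fin mulr_ge0.
have hM0 x : (0 <= (shrink_sqr i x * M x)%:E)%E.
  by rewrite lee_fin mulr_ge0 ?shrink_sqr_ge0.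
have aM0 x : (0 <= (a i * shrink x * shrink_sqr i x * M x)%:E)%E.
  rewrite lee_fin mulr_ge0 // mulr_ge0 ?shrink_sqr_ge0 // mulr_ge0 ?shrink_ge0 //.
  exact: ltW.
have xM0 (x : p.-tuple R) : (0 <= ((0 - tnth x i) ^+ 2 * M x)%:E)%E.
  by rewrite lee_fin mulr_ge0 ?sqr_ge0.
have ME0 x : (0 <= (M x)%:E)%E by rewrite lee_fin.
have c20 : 0 <= 2 * c by rewrite mulr_ge0 // ltW.
have r20 : 0 <= r ^+ 2 by rewrite sqr_ge0.
have v0 : 0 <= s i * tau / D i by rewrite divr_ge0 ?mulr_ge0 ?ltW.
set I := (\int[lebesgue_tuple p]_x (shrink_sqr i x * M x)%:E)%E.
have I0 : (0 <= I)%E by exact: integral_ge0.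
have Ifin : I \is a fin_num by rewrite ge0_fin_numE // integral_shrink_sqr_lty.
have sum_eq : (\int[lebesgue_tuple p]_x (f x * M x)%:E + (2 * c)%:E * I =
   (s i)%:E + c%:E *
     \int[lebesgue_tuple p]_x (a i * shrink x * shrink_sqr i x * M x)%:E)%E.
  rewrite /I -(ge0_integralZl _ measurableT mhM (fun x _ => hM0 x)) ?lee_fin //.
  rewrite -(ge0_integralD _ measurableT (fun x _ => fM0 x) mfM); last 2 first.
  - by move=> x _; apply: mule_ge0; [rewrite lee_fin|exact: hM0].
  - exact: measurable_funeM.
  transitivity (\int[lebesgue_tuple p]_x
      (((r ^+ 2)%:E * ((0 - tnth x i) ^+ 2 * M x)%:E + (s i * tau / D i)%:E * (M x)%:E)
       + c%:E * (a i * shrink x * shrink_sqr i x * M x)%:E))%E.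
    by apply: eq_integral => x _; rewrite -!EFinM -!EFinD fE.
  have h1 x : (0 <= (r ^+ 2)%:E * ((0 - tnth x i) ^+ 2 * M x)%:E)%E.
    by apply: mule_ge0; [rewrite lee_fin|exact: xM0].
  have h2 x : (0 <= (s i * tau / D i)%:E * (M x)%:E)%E.
    by apply: mule_ge0; [rewrite lee_fin|exact: ME0].
  have m1 := measurable_funeM (r ^+ 2)%:E mxM.
  have m2 := measurable_funeM (s i * tau / D i)%:E mME.
  rewrite (ge0_integralD _ measurableT); last 4 first.
  - by move=> x _; rewrite adde_ge0.
  - exact: emeasurable_funD.
  - by move=> x _; apply: mule_ge0; [rewrite lee_fin ltW|exact: aM0].
  - exact: measurable_funeM.
  rewrite (ge0_integralD _ measurableT (fun x _ => h1 x) m1 (fun x _ => h2 x) m2).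
  rewrite (ge0_integralZl _ measurableT mxM (fun x _ => xM0 x)) ?lee_fin //.
  rewrite (ge0_integralZl _ measurableT mME (fun x _ => ME0 x)) ?lee_fin //.
  rewrite (ge0_integralZl _ measurableT maM (fun x _ => aM0 x)) ?lee_fin ?(ltW c0) //.
  rewrite integral_gausses_sqr // integral_gausses // mule1; congr (_ + _)%E.
  rewrite -EFinM -EFinD subr0 expr0n add0r /r /D; congr EFin.
  by field; rewrite gt_eqF // addr_gt0.
suff : (\int[lebesgue_tuple p]_x (f x * M x)%:E + (2 * c)%:E * I <=
    (s i)%:E + (2 * c)%:E * I)%E.
  by rewrite leeD2rE // fin_numM.
rewrite sum_eq; apply: leeD2l; rewrite (mulrC 2 c) (EFinM c 2) -muleA.
apply: lee_wpmul2l; first by rewrite lee_fin ltW.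
exact: integral_shrink_contraction.
Qed.

End shrinkage.

(** * Bounds on the supremum of the ensemble risk *)

Section risk_bounds.
Context {R : realType} {k : nat}.
Let p := k.+3.
Variables (s : 'I_p -> R).
Hypothesis s0 : forall i, 0 < s i.

(** The posterior variance is incurred by every estimator. *)
Lemma ensemble_risk_ge (delta : p.-tuple R -> p.-tuple R) (tau : R) :
  0 < tau -> estimator delta ->
  ((\sum_i s i * tau / (s i + tau))%:E <=
   ensemble_risk (diag_mx (\row_i s i)) delta tau)%E.
Proof.
move=> t0 mdelta; rewrite ensemble_risk_posterior //.
have D0 i : 0 < s i + tau by exact: addr_gt0.
set V := \sum_i _.
have V0 : 0 <= V.
  by apply: sumr_ge0 => i _; rewrite divr_ge0 ?mulr_ge0 ?(ltW t0) ?(ltW (s0 i)) ?(ltW (D0 i)).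
pose M := gausses (fun i => s i + tau) (fun=> 0) : p.-tuple R -> R.
have mM : measurable_fun setT M by exact: measurable_gausses.
have M0 x : 0 <= M x by exact: gausses_ge0.
have mME : measurable_fun setT (fun x => (M x)%:E) by exact/measurable_EFinP.
have ME0 x : (0 <= (M x)%:E)%E by rewrite lee_fin.
rewrite -[leLHS]mule1 -(@integral_gausses _ _ (fun i => s i + tau) (fun=> 0) D0).
rewrite -(ge0_integralZl _ measurableT mME (fun x _ => ME0 x)) ?lee_fin //.
apply: ge0_le_integral => //.
- by move=> x _; rewrite mule_ge0 ?lee_fin.
- exact: measurable_funeM.
- apply/measurable_EFinP; apply: measurable_funM => //.
  apply: measurable_sum => i; apply: measurable_funD => //.
  apply: measurable_funX; apply: measurable_funB.
    exact: (measurableT_comp (measurable_tnth i) mdelta).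
  by apply: measurable_funM => //; exact: measurable_tnth.
- move=> x _; rewrite -EFinM lee_fin ler_wpM2r // /V; apply: ler_sum => i _.
  by rewrite lerDr sqr_ge0.
Qed.

(** The bound of [ensemble_risk_ge] tends to [\sum_i s i] as [tau] grows: the gap
is at most [\sum_i s i ^+ 2 / tau]. *)
Lemma sup_ensemble_risk_ge (delta : p.-tuple R -> p.-tuple R) :
  estimator delta ->
  ((\sum_i s i)%:E <= sup_ensemble_risk (diag_mx (\row_i s i)) delta)%E.
Proof.
move=> mdelta; apply/lee_addgt0Pr => e e0.
pose T := \sum_i s i ^+ 2.
have T0 : 0 <= T by apply: sumr_ge0 => i _; exact: sqr_ge0.
pose tau := (T + 1) / e.
have t0 : 0 < tau by rewrite divr_gt0 // ltr_wpDl.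
apply: (@le_trans _ _ (ensemble_risk (diag_mx (\row_i s i)) delta tau + e%:E)%E); last first.
  by apply: leeD2r; apply: ereal_sup_ubound; exists tau.
apply: le_trans (leeD2r _ (ensemble_risk_ge t0 mdelta)).
rewrite -EFinD lee_fin.
have Te : T / tau <= e.
  rewrite ler_pdivrMr // /tau mulrCA mulfV ?gt_eqF // mulr1; lra.
apply: le_trans (lerD (lexx _) Te).
rewrite /T mulr_suml -big_split /=; apply: ler_sum => i _.
have si := s0 i; have D0 : 0 < s i + tau by rewrite addr_gt0.
rewrite -subr_ge0.
have -> : s i * tau / (s i + tau) + s i ^+ 2 / tau - s i = s i ^+ 3 / (tau * (s i + tau)).
  by field; rewrite !gt_eqF.
by apply: divr_ge0; [exact: exprn_ge0 (ltW si)|exact: mulr_ge0 (ltW t0) (ltW D0)].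
Qed.

End risk_bounds.

Lemma tnth_shrinkage_estimator (R : realType) (k : nat) (s g : 'I_k.+3 -> R)
    (phi : R -> R) x i : (forall i, 0 < s i) ->
  tnth (shrinkage_estimator (diag_mx (\row_i s i)) (diag_mx (\row_i g i)) phi x) i =
  (1 - g i * shrink s g phi x) * tnth x i.
Proof.
move=> s0; rewrite /shrinkage_estimator tnth_mktuple.
set z := (_ *m _) 0 0.
have -> : z = scaled_sqnorm s g x.
  rewrite /z invmx_diag => [|j]; last by rewrite gt_eqF.
  rewrite -(mulmxA (_^T)) mulmx_diag.
  rewrite (_ : \row_i _ = \row_i (g i / s i)); last by apply/rowP => j; rewrite !mxE.
  by rewrite quad_diag; apply: eq_bigr => j _; rewrite mxE.
rewrite mulmxBl mul1mx -scalemxAl mul_diag_mx !mxE /shrink.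
by rewrite mulrBl mul1r mulrA (mulrC (g i)).
Qed.

Theorem theorem3p1 (R : realType) (p : nat) (hp : (3 <= p)%N)
    (sigma g : 'I_p -> R) (phi : R -> R)
    (hsigma_gt0 : forall i, 0 < sigma i ^+ 2)
    (hsigma_decr : forall i j : 'I_p, (i < j)%N -> sigma j ^+ 2 < sigma i ^+ 2)
    (hg : forall i, 0 < g i <= 1)
    (hphi_ge0 : forall z, 0 <= z -> 0 <= phi z)
    (hphi_nondecr : forall y z, 0 <= y -> y <= z -> phi y <= phi z)
    (hphi_concave : convex_function (`[0, +oo[ : set R^o) (fun z => - phi z))
    (hphi_div : forall y z, 0 < y -> y <= z -> phi z / z <= phi y / y)
    (hphi_bound : forall tau, 0 < tau ->
      let a := fun i => g i * (1 + tau / sigma i ^+ 2) in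
      phi (p%:R * fmin a) <= 2 * (p%:R - 2) * (fmin a / fmax a)) :
  let Sigma := diag_mx (\row_i (sigma i ^+ 2)) in
  let G := diag_mx (\row_i g i) in
  ensemble_minimax Sigma (shrinkage_estimator Sigma G phi).
Proof.
case: p hp sigma g hsigma_gt0 hsigma_decr hg hphi_bound => [|[|[|k]]] // _.
move=> sigma g hs _ hg hbound Sigma G.
pose s i := sigma i ^+ 2.
have s0 i : 0 < s i by exact: hs.
have g0 i : 0 < g i by have /andP[] := hg i.
(* As tau grows, fmin a tends to infinity while fmin a / fmax a stays at most
   1, so the assumed bound makes phi bounded. *)
have phi_le z : 0 <= z -> phi z <= 2 * (k.+3%:R - 2).
  move=> z0; pose tau := 1 + \sum_i z * s i / g i.
  have zsg0 i : 0 <= z * s i / g i.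
    by apply: divr_ge0 (ltW (g0 i)); apply: mulr_ge0 (ltW (s0 i)).
  have t0 : 0 < tau.
    rewrite ltr_wpDr // sumr_ge0 //.
  have := hbound _ t0; set a := fun i => _; cbv zeta => bnd.
  have a0 i : 0 < a i by rewrite mulr_gt0 // addr_gt0 // divr_gt0.
  have A0 : 0 < fmin a by exact: lt_fmin.
  have za : z <= fmin a.
    apply: le_fmin => i.
    have zt : z * s i / g i <= tau.
      rewrite /tau (bigD1 i) //= addrCA lerDl addr_ge0 // sumr_ge0 //.
    rewrite /a mulrDr mulr1 mulrA ler_wpDl ?(ltW (g0 i)) //.
    rewrite ler_pdivlMr // mulrC; rewrite ler_pdivrMr // in zt.
    by rewrite mulrC (mulrC (g i)).
  have zp : z <= k.+3%:R * fmin a.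
    by apply: le_trans za _; rewrite ler_peMl ?(ltW A0) // ler1n.
  apply: le_trans (hphi_nondecr _ _ z0 zp) (le_trans bnd _).
  have am : 0 < fmax a by apply: lt_le_trans (le_fmax a ord0).
  apply: ler_piMr; first by rewrite mulr_ge0 // subr_ge0 ler_nat.
  by rewrite ler_pdivrMr // mul1r (le_trans (fmin_le a ord0) (le_fmax a ord0)).
have mdelta : estimator (shrinkage_estimator Sigma G phi).
  apply/measurable_fun_tnthP => i; rewrite /comp.
  under eq_fun do rewrite tnth_shrinkage_estimator //.
  apply: measurable_funM; last exact: measurable_tnth.
  apply: measurable_funB => //; apply: measurable_funM => //.
  exact: measurable_shrink.
have risk_le tau : 0 < tau ->
    (ensemble_risk Sigma (shrinkage_estimator Sigma G phi) tau <= (\sum_i s i)%:E)%E.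
  move=> t0; rewrite ensemble_risk_posterior //.
  under eq_integral do rewrite mulr_suml -sumEFin.
  rewrite ge0_integral_sum //.
  - rewrite -sumEFin; apply: lee_sum => i _.
    under eq_integral do rewrite tnth_shrinkage_estimator //.
    apply: (integral_coordinate_loss_le s0 g0 t0 _ _ _ _ _ phi_le) => //.
    exact: hbound.
  - move=> i; apply/measurable_EFinP; apply: measurable_funM; last first.
      exact: measurable_gausses.
    apply: measurable_funD => //; apply: measurable_funX.
    apply: measurable_funB; first exact: (measurableT_comp (measurable_tnth i) mdelta).
    by apply: measurable_funM => //; exact: measurable_tnth.
  - move=> i x _; rewrite lee_fin mulr_ge0 ?gausses_ge0 // addr_ge0 ?sqr_ge0 //.
    apply: divr_ge0; first exact: mulr_ge0 (ltW (s0 i)) (ltW t0).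
    exact: addr_ge0 (ltW (s0 i)) (ltW t0).
have sup_le : (sup_ensemble_risk Sigma (shrinkage_estimator Sigma G phi)
    <= (\sum_i s i)%:E)%E.
  by apply: ge_ereal_sup => _ [tau /= t0 <-]; exact: risk_le.
split => //; apply/eqP; rewrite eq_le; apply/andP; split.
- apply: le_trans sup_le _; apply: le_ereal_inf_tmp => _ [d md <-].
  exact: sup_ensemble_risk_ge.
- by apply: ereal_inf_lbound; exists (shrinkage_estimator Sigma G phi).
Qed.
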